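(* Let $\Delta$ be a simplicial complex on $X=\{x_1,\dots,x_n\}$, let $\alpha=(k_1,\dots,k_n)$ be a vector of positive integers, and let $K$ be a field. Let $I(\Delta)\subseteq K[x_1,\dots,x_n]$ and $I(\Delta^\alpha)\subseteq K[x_{ij}: 1\le i\le n,\ 1\le j\le k_i]$ be the facet ideals of $\Delta$ and of its expansion $\Delta^\alpha$. Then $\mathrm{reg}(I(\Delta))=\mathrm{reg}(I(\Delta^\alpha))$. Moreover, $I(\Delta)$ has a linear resolution if and only if $I(\Delta^\alpha)$ has a linear resolution.
   Context: Simplicial complexes are finite and contain the empty face; $\mathcal F(\Delta)$ is the set of facets (maximal faces) of $\Delta$. Expansion: for $\alpha=(k_1,\dots,k_n)$ put $X^\alpha=\{x_{ij}: 1\le i\le n,\ 1\le j\le k_i\}$. The expansion $\Delta^\alpha$ is the simplicial complex on $X^\alpha$ whose facets are the sets $\{x_{i_1j_1},\dots,x_{i_rj_r}\}$ with $\{x_{i_1},\dots,x_{i_r}\}\in\mathcal F(\Delta)$ (distinct $i_1,\dots,i_r$) and $1\le j_m\le k_{i_m}$ for all $m$. Facet ideal: for a complex $\Gamma$ on a set of variables, $I(\Gamma)=(x^F: F\in\mathcal F(\Gamma))$ with $x^F=\prod_{x\in F}x$, in the polynomial ring over $K$ on all these variables. Polynomial rings carry the standard $\mathbb Z$-grading. For a finitely generated graded module $M$ with graded Betti numbers $\beta_{i,j}(M)$, $\mathrm{reg}(M)=\max\{j-i:\beta_{i,j}(M)\ne 0\}$ is the Castelnuovo-Mumford regularity. A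 graded ideal $I$ has a linear resolution if there is $d$ with $\beta_{i,j}(I)=0$ for all $i$ and all $j\neq i+d$. *)

(* Defs.v *)
From HB Require Import structures.
From mathcomp Require Import all_boot all_order all_algebra.
From mathcomp Require Import mpoly.
From Stdlib Require Import ClassicalEpsilon.

Set Implicit Arguments.
Unset Strict Implicit.
Unset Printing Implicit Defensive.

Import Order.TTheory GRing.Theory Num.Theory.
Local Open Scope ring_scope.

(* An element v of V need not be a vertex: [set v] \in D is not required. *)
Definition simplicial_complex (V : finType) (D : {set {set V}}) : Prop :=
  set0 \in D /\
  (forall F G : {set V}, F \in D -> G \subset F -> G \in D).

Definition facets (V : finType) (D : {set {set V}}) : {set {set V}} :=
  [set F : {set V} | maxset (fun G => G \in D) F].

Definition generated_complex (V : finType) (A : {set {set V}}) :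
    {set {set V}} :=
  [set G : {set V} | [exists F in A, G \subset F]].

(* The variable x_{ij} is Tagged _ j with tag i; the range 1 <= j <= k_i is
   shifted to j < k i. *)
Definition expansion_vertex (V : finType) (k : V -> nat) : finType :=
  {i : V & 'I_(k i)}.

(* The sets {x_{i_1 j_1}, ..., x_{i_r j_r}} with i_1, ..., i_r pairwise
   distinct and {x_{i_1}, ..., x_{i_r}} a facet. *)
Definition expansion_facets (V : finType) (k : V -> nat)
    (D : {set {set V}}) : {set {set expansion_vertex k}} :=
  [set H : {set expansion_vertex k} |
     dinjectiveb (fun u : expansion_vertex k => tag u) H
     && ([set tag u | u in H] \in facets D)].

Definition expansion (V : finType) (k : V -> nat) (D : {set {set V}}) :
    {set {set expansion_vertex k}} :=
  generated_complex (expansion_facets k D).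

Lemma facets_expansion (V : finType) (k : V -> nat) (D : {set {set V}}) :
  facets (expansion k D) = expansion_facets k D.
Proof.
have anti (H H' : {set expansion_vertex k}) :
    H \in expansion_facets k D -> H' \in expansion_facets k D ->
    H \subset H' -> H' = H.
  rewrite !inE => /andP[/dinjectiveP injH /maxsetP[_ maxH]].
  move=> /andP[/dinjectiveP injH' /maxsetP[DH' _]] sHH'.
  have tE := maxH _ DH' (imsetS _ sHH').
  apply/esym/eqP; rewrite eqEcard sHH' /=.
  by rewrite -(card_in_imset injH) -(card_in_imset injH') tE.
apply/setP=> H; rewrite [LHS]inE; apply/maxsetP/idP => [[HD maxH]|HA].
  move: (HD); rewrite inE => /exists_inP[H' H'A sHH'].
  suff <- : H' = H by [].
  by apply: maxH sHH'; rewrite inE; apply/exists_inP; exists H'.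
split=> [|H1 H1D sHH1].
  by rewrite inE; apply/exists_inP; exists H.
move: H1D; rewrite inE => /exists_inP[H2 H2A sH12].
apply/eqP; rewrite eqEsubset sHH1 andbT.
by rewrite -(anti _ _ HA H2A (subset_trans sHH1 sH12)).
Qed.

(* K[x_v : v in V], the variable x_v being 'X_(enum_rank v). *)
Notation poly_ring K V := {mpoly K[#|(V : finType)|]}.

Definition face_monomial (K : fieldType) (V : finType) (F : {set V}) :
    poly_ring K V :=
  \prod_(v in F) 'X_(enum_rank v).

Definition facet_ideal (K : fieldType) (V : finType) (D : {set {set V}})
    (p : poly_ring K V) : Prop :=
  exists c : {set V} -> poly_ring K V,
    p = \sum_(F in facets D) c F * face_monomial K F.
Arguments facet_ideal K {V} D p.

(* [d.-homog] of the library with an integer degree; for d < 0 only 0 is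
   homogeneous of degree d. *)
Definition zhomog (K : fieldType) (N : nat) (d : int) (p : {mpoly K[N]}) :
    bool :=
  all (fun m : 'X_{1..N} => (mdeg m)%:Z == d) (msupp p).

(* With S = K[x_1, ..., x_N], a resolution
     ... -> F_2 -> F_1 -> F_0 -> I -> 0,
   F_i = S(- twist i 0) + ... + S(- twist i (rk i - 1)) (direct sum).
   Elements of F_i are row vectors and maps are right multiplications; the
   homogeneity conditions say that all maps have degree 0, and minimality that
   diff i (F_(i+1)) is contained in (x_1, ..., x_N) F_i. *)
Record min_free_resolution (K : fieldType) (N : nat)
    (I : {mpoly K[N]} -> Prop) := MinFreeResolution {
  rk : nat -> nat;
  twist : forall i, 'I_(rk i) -> int;
  augm : 'cV[{mpoly K[N]}]_(rk 0);
  diff : forall i, 'M[{mpoly K[N]}]_(rk i.+1, rk i);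
  augm_homog : forall a, zhomog (twist a) (augm a 0);
  diff_homog : forall i a b, zhomog (twist a - twist b) (diff i a b);
  augm_image : forall p : {mpoly K[N]},
    I p <-> exists u : 'rV_(rk 0), p = (u *m augm) 0 0;
  exact_augm : forall u : 'rV_(rk 0),
    u *m augm = 0 <-> exists w : 'rV_(rk 1), u = w *m diff 0;
  exact_diff : forall i (u : 'rV_(rk i.+1)),
    u *m diff i = 0 <-> exists w : 'rV_(rk i.+2), u = w *m diff i.+1;
  diff_minimal : forall i a b, (diff i a b)@_(0%MM) = 0
}.

(* beta_{i,j}(I): the number of copies of S(-j) in the i-th module of a minimal
   graded free resolution of I. *)
Definition betti (K : fieldType) (N : nat) (I : {mpoly K[N]} -> Prop)
    (i : nat) (j : int) : nat :=
  epsilon (inhabits 0%N) (fun b : nat =>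
    exists F : min_free_resolution I, b = #|[set a | @twist _ _ _ F i a == j]|).

(* Unspecified if A has no maximum. *)
Definition int_max (A : int -> Prop) : int :=
  epsilon (inhabits 0) (fun r : int => A r /\ (forall s, A s -> s <= r)).

Definition regularity (K : fieldType) (N : nat) (I : {mpoly K[N]} -> Prop) :
    int :=
  int_max (fun r => exists (i : nat) (j : int),
    betti I i j <> 0%N /\ r = j - i%:Z).

Definition has_linear_resolution (K : fieldType) (N : nat)
    (I : {mpoly K[N]} -> Prop) : Prop :=
  exists d : int, forall (i : nat) (j : int),
    j <> i%:Z + d -> betti I i j = 0%N.

(* Main.v *)
Require Import Defs.
From mathcomp Require Import all_boot all_order all_algebra.
From mathcomp Require Import mpoly.
From mathcomp Require Import ring zify.
From Stdlib Require Import Classical ClassicalEpsilon.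
From Stdlib Require Import FunctionalExtensionality PropExtensionality.

(* The graded Betti numbers of a monomial ideal I are read off Koszul homology:
   for a minimal free resolution with syzygy modules M_i, the long exact
   sequences of 0 -> M_(i+1) -> F_i -> M_i -> 0 identify the degree j part of
   H_i(x; I) with that of H_0(x; M_i), the space of minimal generators of M_i of
   degree j. The Koszul complex splits by multidegree. For a facet ideal the
   strands at non-squarefree multidegrees are cones, and the strand at a set B
   of vertices is the complex of the s included in B such that B \ s contains a
   facet. If B contains two copies u, v of one vertex, then this complex is a
   cone with apex u away from v, hence the suspension of the link of v, which is
   the complex of B \ {v}: homological degree and multidegree drop by one
   together. Iterating reaches a B meeting each fibre of the expansion at most
   once, that is, a vertex set of Delta. So both ideals have the same set of
   differences j - i with beta_(i,j) <> 0, and this set determines regularity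
   and linearity. Minimal resolutions exist because H_i(x; I) vanishes in
   degrees larger than the number of variables, so that every syzygy module is
   generated in bounded degrees. *)

Set Implicit Arguments.
Unset Strict Implicit.
Unset Printing Implicit Defensive.

Import Order.TTheory GRing.Theory Num.Theory.
Local Open Scope ring_scope.

(** * Signed differentials and strands *)

(* A tournament suffices for the Koszul signs, and it can be pulled back along an
   injection of vertex sets, whatever the enumerations of these sets. *)
Definition tournament (V : finType) (lt : rel V) : Prop :=
  forall v w : V, v != w -> lt v w = ~~ lt w v.

Section Differential.

Variables (V : finType) (lt : rel V).
Hypothesis lt_tour : tournament lt.

Definition inversions (v : V) (s : {set V}) : nat :=
  (\sum_(w in s) lt w v)%N.

Lemma inversionsU1 v w (s : {set V}) :
  w \notin s -> inversions v (w |: s) = (lt w v + inversions v s)%N.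
Proof. by move=> ws; rewrite /inversions big_setU1. Qed.

(** The value at [s] is the coefficient of the exterior basis element of [s]; it collects the terms
    that remove [v] from [v |: s]. For [x] constantly 1 this is the reduced simplicial boundary. *)
Definition koszul (R : comNzRingType) (W : lmodType R) (x : V -> R)
    (c : {set V} -> W) (s : {set V}) : W :=
  \sum_(v | v \notin s) ((-1) ^+ inversions v s * x v) *: c (v |: s).

Lemma koszulD (R : comNzRingType) (W : lmodType R) (x : V -> R)
    (c d : {set V} -> W) s :
  koszul x (fun t => c t + d t) s = koszul x c s + koszul x d s.
Proof.
by rewrite /koszul -big_split; apply: eq_bigr => v _; rewrite scalerDr.
Qed.

Lemma koszulN (R : comNzRingType) (W : lmodType R) (x : V -> R)
    (c : {set V} -> W) s :
  koszul x (fun t => - c t) s = - koszul x c s.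
Proof.
by rewrite /koszul -sumrN; apply: eq_bigr => v _; rewrite scalerN.
Qed.

Lemma eq_koszul (R : comNzRingType) (W : lmodType R) (x : V -> R)
    (c d : {set V} -> W) : c =1 d -> koszul x c =1 koszul x d.
Proof. by move=> cd s; apply: eq_bigr => v _; rewrite cd. Qed.

Lemma koszul_eq0 (R : comNzRingType) (W : lmodType R) (x : V -> R)
    (c : {set V} -> W) s : (forall t, c t = 0) -> koszul x c s = 0.
Proof. by move=> c0; rewrite /koszul big1 // => v _; rewrite c0 scaler0. Qed.

(** Removing [v] and [w] in either order gives the same term up to sign, and exactly one of [lt v w]
    and [lt w v] holds, so the two orders cancel. *)
Lemma koszul_koszul (R : comNzRingType) (W : lmodType R) (x : V -> R)
    (c : {set V} -> W) s : koszul x (koszul x c) s = 0.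
Proof.
pose T v w : W :=
  (((-1) ^+ inversions v s * x v) * ((-1) ^+ inversions w (v |: s) * x w))
    *: c (w |: (v |: s)).
pose Q v w := [&& v \notin s, w \notin s & v != w].
have antiT v w : Q v w -> T v w = - T w v.
  case/and3P=> vs ws vw; rewrite /T -scaleNr setUCA; congr (_ *: _).
  rewrite !inversionsU1 // (lt_tour vw) !exprD.
  by case: (lt w v) => /=; rewrite ?expr0 ?expr1; ring.
have -> : koszul x (koszul x c) s = \sum_v \sum_(w | Q v w) T v w.
  rewrite /koszul big_mkcond; apply: eq_bigr => v _.
  case: ifP => vs; last first.
    by rewrite big_pred0 // => w; rewrite /Q vs.
  rewrite scaler_sumr; apply: eq_big => [w|w _]; last by rewrite scalerA.
  by rewrite /Q vs in_setU1 negb_or andbC eq_sym.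
rewrite pair_big_dep /= (bigID (fun p => lt p.1 p.2)) /= addrC.
rewrite (reindex_inj (h := fun p => (p.2, p.1))) /=; last first.
  by case=> a b [a' b'] [-> ->].
rewrite (eq_bigl (fun p => Q p.1 p.2 && lt p.1 p.2)); last first.
  case=> v w /=; rewrite /Q andbCA [v == w]eq_sym.
  by apply: andb_id2l => /and3P[_ _ vw]; rewrite (lt_tour vw) negbK.
rewrite -big_split big1 //= => -[v w] /= /andP[q _].
by rewrite (antiT _ _ q) subrr.
Qed.

End Differential.

(** Regularity and linearity depend only on which Betti numbers vanish, so a cycle that bounds
    nothing replaces the dimension of a quotient. *)
Definition homology_nonzero (V : finType) (lt : rel V) (R : comNzRingType)
    (W : lmodType R) (x : V -> R) (C : nat -> ({set V} -> W) -> Prop)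
    (p : nat) : Prop :=
  exists c : {set V} -> W,
    [/\ C p c, koszul lt x c =1 (fun=> 0) &
        ~ exists2 b, C p.+1 b & koszul lt x b =1 c].

(** * Simplicial chains, cones and suspensions *)

Section Strands.

Variables (K : fieldType) (V : finType) (lt : rel V).
Hypothesis lt_tour : tournament lt.

Implicit Types (P : {set V} -> Prop) (f g : {set V} -> K^o) (s t : {set V}).

Notation bd := (koszul lt (W := K^o) (fun _ : V => (1 : K))).

Lemma bdE f s :
  bd f s = \sum_(v | v \notin s) (-1) ^+ inversions lt v s * f (v |: s).
Proof. by apply: eq_bigr => v _; rewrite mulr1. Qed.

(** The degree is the cardinality, one more than the dimension; degree 0 belongs to the empty face,
    so the homology is reduced. *)
Definition simplicial_chain P (p : nat) f : Prop :=
  forall s, f s != 0 -> P s /\ #|s| = p.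

Definition simplicial_nonzero P (p : nat) : Prop :=
  homology_nonzero lt (fun=> 1) (simplicial_chain P) p.

Lemma eq_simplicial_nonzero P P' p :
  (forall s, P s <-> P' s) -> simplicial_nonzero P p -> simplicial_nonzero P' p.
Proof.
move=> PP' [c [Cc dc nb]]; exists c; split=> // [s /Cc[/PP' ? ?]|[b Cb db]] //.
by apply: nb; exists b => // s /Cb[/PP' ? ?].
Qed.

(** Signed exterior multiplication by the basis element of [u]. *)
Definition cone_op (u : V) f s : K^o :=
  if u \in s then (-1) ^+ inversions lt u (s :\ u) * f (s :\ u) else 0.

(** Inserting [u] and removing it again gives back [f]; inserting [u] anticommutes with removing any
    other vertex. *)
Lemma cone_homotopy u f s : bd (cone_op u f) s + cone_op u (bd f) s = f s.
Proof.
rewrite {2}/cone_op !bdE; case: (boolP (u \in s)) => us; last first.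
  rewrite addr0 (bigD1 u) //= big1 ?addr0 => [|v /andP[vs vu]].
    by rewrite /cone_op setU11 setU1K // mulrA -expr2 sqrr_sign mul1r.
  by rewrite /cone_op in_setU1 (negPf us) orbF eq_sym (negPf vu) mulr0.
have usu : u \notin s :\ u by rewrite setD11.
rewrite [X in _ + _ * X](bigD1 u) //= setD1K // mulrDr.
rewrite mulrA -expr2 sqrr_sign mul1r addrCA.
rewrite -[RHS]addr0; congr (_ + _); rewrite mulr_sumr.
rewrite [X in _ + X](eq_bigl (fun v => v \notin s)); last first.
  move=> v; rewrite in_setD1 negb_and negbK andb_orl andbN orFb andb_idr //.
  by apply: contraNneq => ->.
rewrite -big_split big1 //= => v vs.
have vu : v != u by apply: contraNneq vs => ->.
rewrite /cone_op in_setU1 us orbT.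
have -> : (v |: s) :\ u = v |: (s :\ u).
  by apply/setP=> w; rewrite !inE; case: (eqVneq w v) => // ->; rewrite vu.
have vsu : v \notin s :\ u by rewrite !inE vu.
rewrite (inversionsU1 _ _ vsu) -{1}(setD1K us) (inversionsU1 _ _ usu).
rewrite (lt_tour vu) !exprD.
by case: (lt u v) => /=; rewrite ?expr0 ?expr1; ring.
Qed.

Lemma cone_acyclic u P p f :
  (forall s, P s -> P (u |: s)) -> simplicial_chain P p f ->
  bd f =1 (fun=> 0) -> exists2 g, simplicial_chain P p.+1 g & bd g =1 f.
Proof.
move=> Pu Cf df; exists (cone_op u f) => s.
  rewrite /cone_op; case: ifP => us; rewrite ?eqxx // mulf_eq0 negb_or.
  case/andP=> _ /Cf[Ps <-]; split; last by rewrite [LHS](cardsD1 u) us.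
  by rewrite -(setD1K us); apply: Pu.
rewrite -[RHS](cone_homotopy u) [X in _ = _ + X](_ : _ = 0) ?addr0 //.
by rewrite /cone_op df mulr0 if_same.
Qed.

(** Writing a chain as [a] plus [v] times [b], where [a] and [b] avoid [v], this is the part [b], up
    to the sign convention. *)
Definition link_op (v : V) f s : K^o :=
  if v \in s then 0 else (-1) ^+ inversions lt v s * f (v |: s).

Lemma bd_link v f s : bd (link_op v f) s = - link_op v (bd f) s.
Proof.
rewrite {2}/link_op !bdE; case: (boolP (v \in s)) => vs.
  rewrite oppr0 big1 // => w _.
  by rewrite /link_op in_setU1 vs orbT mulr0.
rewrite mulr_sumr -sumrN (bigD1 v) //= {1}/link_op setU11 mulr0 add0r.
apply: eq_big => [w|w /andP[ws wv]]; first by rewrite in_setU1 negb_or andbC.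
have vw : v != w by rewrite eq_sym.
rewrite /link_op in_setU1 (negPf vw) (negPf vs) /= !inversionsU1 // setUCA.
rewrite (lt_tour vw) !exprD.
by case: (lt w v) => /=; rewrite ?expr0 ?expr1; ring.
Qed.

(* [v] and [u] are parallel: away from [v] the complex is a cone with apex
   [u], so that it is the suspension of the link of [v]. *)
Section Parallel.

Variables (u v : V) (P : {set V} -> Prop).
Hypothesis uv : u != v.
Hypothesis P_cone : forall s, v \notin s -> P s -> P (u |: s).
Hypothesis P_del : forall s, P (v |: s) -> P s.

(** A chain vanishing on the faces through [v] lives on the deletion of [v], a cone with apex
    [u]. *)
Lemma deletion_acyclic p f :
  simplicial_chain P p f -> (forall s, v \in s -> f s = 0) ->
  bd f =1 (fun=> 0) -> exists2 g, simplicial_chain P p.+1 g & bd g =1 f.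
Proof.
move=> Cf f0 df; pose A s := v \notin s /\ P s.
have [s [vs Ps]|s fs|g Cg dg] := @cone_acyclic u A p f _ _ df.
- by rewrite /A in_setU1 negb_or eq_sym uv; split=> //; apply: P_cone.
- have [Ps cs] := Cf _ fs; split=> //; split=> //.
  by apply: contra fs => /f0 ->.
by exists g => // s /Cg[[]].
Qed.

Lemma suspension0 : ~ simplicial_nonzero P 0.
Proof.
case=> f [Cf df []]; apply: deletion_acyclic => // s vs.
apply/eqP/negPn/negP => /Cf[_ /eqP]; rewrite cards_eq0 => /eqP s0.
by rewrite s0 inE in vs.
Qed.

(** If the link part of [f] bounds some [m] in the link, adding to [f] the boundary of the cone over
    [m] with apex [v] removes all faces through [v], and what remains bounds in the acyclic
    deletion. *)
Lemma suspension p :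
  simplicial_nonzero P p.+1 ->
  simplicial_nonzero (fun s => v \notin s /\ P (v |: s)) p.
Proof.
case=> f [Cf df nbf]; exists (link_op v f); split=> [s||[m Cm dm]].
- rewrite /link_op; case: ifP => vs; rewrite ?eqxx // mulf_eq0 negb_or.
  by case/andP=> _ /Cf[Ps]; rewrite cardsU1 vs => -[].
- by move=> s; rewrite bd_link /link_op df mulr0 if_same oppr0.
have Chm : simplicial_chain P p.+2 (cone_op v m).
  move=> s; rewrite /cone_op; case: ifP => vs; rewrite ?eqxx //.
  rewrite mulf_eq0 negb_or.
  by case/andP=> _ /Cm[[_]]; rewrite setD1K // => Ps <-; rewrite (cardsD1 v) vs.
have mv s : v \in s -> m s = 0.
  by move=> vs; apply/eqP/negPn/negP => /Cm[[]]; rewrite vs.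
(* By [cone_homotopy] the correction equals [m] minus the part of [f] on the faces through [v]. *)
pose f' s := f s + bd (cone_op v m) s.
have f'E s : f' s = f s + (m s - cone_op v (link_op v f) s).
  rewrite -(cone_homotopy v m s) /f'; congr (_ + _).
  by rewrite {2}/cone_op /cone_op dm addrK.
have lf s : v \in s -> cone_op v (link_op v f) s = f s.
  move=> vs; rewrite /cone_op vs /link_op setD11 setD1K // mulrA.
  by rewrite -expr2 sqrr_sign mul1r.
have f'v s : v \in s -> f' s = 0.
  by move=> vs; rewrite f'E lf // mv // sub0r subrr.
have df' : bd f' =1 (fun=> 0).
  by move=> s; rewrite koszulD df add0r koszul_koszul.
have [s f's|g Cg dg] := @deletion_acyclic p.+1 f' _ f'v df'.
  have vs : v \notin s by apply: contra f's => /f'v->.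
  move: f's; rewrite f'E /cone_op (negPf vs) subr0.
  have [-> | /Cf//] := eqVneq (f s) 0.
  by rewrite add0r => /Cm[[_ /P_del]].
apply: nbf; exists (fun s => g s - cone_op v m s) => s; last first.
  by rewrite koszulD koszulN dg /f' addrK.
have [->|/Cg //] := eqVneq (g s) 0.
by rewrite sub0r oppr_eq0 => /Chm.
Qed.

End Parallel.

End Strands.

(** * Relabelling of vertices along an injection *)

Section Relabelling.

Variables (K : fieldType) (V T : finType) (lt : rel V) (e : T -> V).
Hypothesis e_inj : injective e.
Variable P : {set V} -> Prop.
Hypothesis P_codom : forall s, P s -> s \subset e @: [set: T].

Notation bdV := (koszul lt (W := K^o) (fun _ : V => (1 : K))).
Notation bdT := (koszul (relpre e lt) (W := K^o) (fun _ : T => (1 : K))).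

Let supported (f : {set V} -> K^o) :=
  forall s, f s != 0 -> s \subset e @: [set: T].

Let codomK (s : {set V}) : s \subset e @: [set: T] -> e @: (e @^-1: s) = s.
Proof.
move=> /subsetP sub; apply/setP=> v; apply/imsetP/idP => [[t]|vs].
  by rewrite inE => et ->.
by case/imsetP: (sub v vs) => t _ vE; exists t => //; rewrite inE -vE.
Qed.

Let imsetK (t : {set T}) : e @^-1: (e @: t) = t.
Proof. by apply/setP=> x; rewrite inE mem_imset. Qed.

(** A vertex outside the image of [e] contributes nothing, since [f] vanishes on the sets containing
    it; on the image the signs agree because the tournament is pulled back. *)
Let bd_imset f (t : {set T}) :
  supported f -> bdV f (e @: t) = bdT (fun t1 : {set T} => f (e @: t1)) t.
Proof.
move=> sf; rewrite !bdE.
rewrite (bigID (fun v => v \in [set e t' | t' in setT])) /= addrC big1 ?add0r.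
  rewrite (eq_bigl (fun v => v \in e @: [set v | v \notin t])) => [|v].
    rewrite big_imset => [|? ? _ _ /e_inj //]; apply: eq_big => [v|v vt].
      by rewrite inE.
    rewrite imsetU1; congr (_ ^+ _ * _).
    by rewrite /inversions big_imset // => ? ? _ _ /e_inj.
  apply/andP/imsetP => [[vt /imsetP[x _ vE]]|[x]]; last first.
    by rewrite inE => xt ->; rewrite !mem_imset.
  by exists x; rewrite // inE; rewrite vE mem_imset in vt.
move=> v /andP[_ vn]; have [->|/sf/subsetP sub] := eqVneq (f (v |: e @: t)) 0.
  by rewrite mulr0.
by rewrite sub ?setU11 in vn.
Qed.

Let bd_supported f : supported f -> supported (bdV f).
Proof.
move=> sf s; apply: contraNT => ns; rewrite bdE big1 // => v vs.
have [->|/sf sub] := eqVneq (f (v |: s)) 0; first by rewrite mulr0.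
by case/negP: ns; apply: subset_trans sub; apply: subsetUr.
Qed.

Let chain_supported p (f : {set V} -> K^o) :
  simplicial_chain P p f -> supported f.
Proof. by move=> Cf s /Cf[/P_codom]. Qed.

Let push (g : {set T} -> K^o) (s : {set V}) : K^o :=
  if s \subset e @: [set: T] then g (e @^-1: s) else 0.

Let push_supported g : supported (push g).
Proof. by move=> s; rewrite /push; case: ifP; rewrite ?eqxx. Qed.

Let push_imset g (t : {set T}) : push g (e @: t) = g t.
Proof. by rewrite /push imsetK imsetS ?subsetT. Qed.

Let eq_supported f f' : supported f -> supported f' ->
  (forall t : {set T}, f (e @: t) = f' (e @: t)) -> f =1 f'.
Proof.
move=> sf sf' ff' s; case: (boolP (s \subset e @: [set: T])) => sub.
  by rewrite -(codomK sub) ff'.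
have [->|/sf] := eqVneq (f s) 0; last by rewrite (negPf sub).
by have [->|/sf'] := eqVneq (f' s) 0; last by rewrite (negPf sub).
Qed.

Let push_chain p g :
  simplicial_chain (fun t : {set T} => P (e @: t)) p g ->
  simplicial_chain P p (push g).
Proof.
move=> Cg s gs; rewrite -(codomK (push_supported gs)) card_imset //.
by apply: Cg; rewrite -push_imset codomK // (push_supported gs).
Qed.

Let pull_chain p (f : {set V} -> K^o) : simplicial_chain P p f ->
  simplicial_chain (fun t : {set T} => P (e @: t)) p
    (fun t : {set T} => f (e @: t)).
Proof. by move=> Cf t /Cf[]; rewrite card_imset. Qed.

(** Restriction along [e] and extension by zero ([push]) are inverse chain maps. *)
Lemma simplicial_nonzero_relabel p :
  simplicial_nonzero K lt P p <->
  simplicial_nonzero K (relpre e lt) (fun t : {set T} => P (e @: t)) p.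
Proof.
split=> [[f [Cf df nbf]]|[g [Cg dg nbg]]].
  have sf := chain_supported Cf.
  exists (fun t : {set T} => f (e @: t)); split=> [|t|[b Cb db]].
  - exact: pull_chain.
  - by rewrite -bd_imset // df.
  apply: nbf; exists (push b); first exact: push_chain.
  apply: eq_supported => // [|t]; first exact: bd_supported.
  rewrite bd_imset // -[RHS]db; apply: eq_koszul => t'; exact: push_imset.
exists (push g); split=> [||[b Cb db]]; first exact: push_chain.
  apply: eq_supported => [|s|t]; first exact: bd_supported.
    by rewrite eqxx.
  rewrite bd_imset // -[RHS](dg t); apply: eq_koszul => t'; exact: push_imset.
apply: nbg; exists (fun t : {set T} => b (e @: t)); first exact: pull_chain.
by move=> t; rewrite -bd_imset ?db ?push_imset //; apply: chain_supported Cb.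
Qed.

End Relabelling.

(** * Multigraded strands of the Koszul complex *)

Lemma functional_choice (A B : Type) (Q : A -> B -> Prop) :
  (forall a, exists b, Q a b) -> exists f, forall a, Q a (f a).
Proof.
move=> ex.
exists (fun a => sval (constructive_indefinite_description _ (ex a))) => a.
by case: constructive_indefinite_description.
Qed.

Lemma mcoeffMXU (K : fieldType) (N : nat) (p : {mpoly K[N]}) (i : 'I_N)
    (m : 'X_{1..N}) :
  ('X_i * p)@_m = if m i != 0%N then p@_(m - U_(i)) else 0.
Proof.
case: ifPn => [|/negPn/eqP mi].
  rewrite -lep1mP => le; rewrite -[in LHS](submK le) mulrC addmC.
  by rewrite mcoeffMX.
apply/eqP; rewrite mcoeff_eq0 mulrC (perm_mem (msuppMX _ _)).
apply/mapP => -[k _ mE]; move: mi.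
by rewrite mE mnmDE mnm1E eqxx.
Qed.

Lemma mpoly_of_coefs (K : fieldType) (N : nat) (k : nat)
    (h : 'X_{1..N} -> K) :
  (forall m, h m != 0 -> (mdeg m < k)%N) ->
  {p : {mpoly K[N]} | forall m, p@_m = h m}.
Proof.
move=> hk; exists (\sum_(m : 'X_{1..N < k}) h m *: 'X_[m]) => m.
have [mk|mk] := ltnP (mdeg m) k; first exact: mcoeff_mpoly.
have [->|/hk] := eqVneq (h m) 0; last by rewrite ltnNge mk.
rewrite raddf_sum big1 //= => b _; rewrite mcoeffZ mcoeffX.
case: eqP => [bm|_]; last by rewrite mulr0.
by rewrite -bm leqNgt bmdeg in mk.
Qed.

Section MonomialKoszul.

Variables (K : fieldType) (V : finType) (lt : rel V).
Hypothesis lt_tour : tournament lt.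

Notation S := {mpoly K[#|V|]}.
Notation mon := 'X_{1..#|V|}.
Notation vars := (fun v : V => 'X_(enum_rank v) : S).
Notation kd := (koszul lt vars).
Notation bd := (koszul lt (W := K^o) (fun _ : V => (1 : K))).

Definition indicator (s : {set V}) : mon :=
  [multinom (enum_val i \in s : nat) | i < #|V|].

Lemma indicatorE (s : {set V}) v : indicator s (enum_rank v) = (v \in s).
Proof. by rewrite mnmE enum_rankK. Qed.

Lemma mnm_rankP (m n : mon) :
  (forall v, m (enum_rank v) = n (enum_rank v)) -> m = n.
Proof. by move=> mn; apply/mnmP => i; rewrite -(enum_valK i). Qed.

Lemma lem_rankP (m n : mon) :
  reflect (forall v, (m (enum_rank v) <= n (enum_rank v))%N) (m <= n)%MM.
Proof.
by apply: (iffP mnm_lepP) => le v //; rewrite -(enum_valK v).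
Qed.

Lemma indicatorU1 v (s : {set V}) :
  v \notin s -> indicator (v |: s) = (U_(enum_rank v) + indicator s)%MM.
Proof.
move=> vs; apply: mnm_rankP => w.
rewrite mnmDE !indicatorE mnm1E (inj_eq enum_rank_inj) in_setU1.
by case: (eqVneq w v) => // ->; rewrite (negPf vs).
Qed.

Lemma mdeg_indicator (s : {set V}) : mdeg (indicator s) = #|s|.
Proof.
rewrite mdegE (reindex (@enum_rank V)) /=; last first.
  by exists enum_val => ? _; rewrite ?enum_rankK ?enum_valK.
under eq_bigr do rewrite indicatorE.
rewrite -sum1_card [RHS]big_mkcond /=.
by apply: eq_bigr => v _; case: (v \in s).
Qed.

(* The part of multidegree [b] of a Koszul chain. *)
Definition strand (b : mon) (c : {set V} -> S^o) (s : {set V}) : K^o :=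
  if (indicator s <= b)%MM then (c s : S)@_(b - indicator s) else 0.

(** Multiplication by the variable of [v] moves the monomial [b - indicator (v |: s)] to
    [b - indicator s]; within one multidegree all variables thus act as 1. *)
Lemma strand_koszul b c : strand b (kd c) =1 bd (strand b c).
Proof.
move=> s; rewrite bdE /strand; case: ifPn => sb; last first.
  rewrite big1 // => v vs; rewrite ifN ?mulr0 //; apply: contra sb.
  by apply: lepm_trans; rewrite indicatorU1 // lem_addl.
rewrite raddf_sum /=; apply: eq_bigr => v vs.
rewrite /GRing.scale /= -mulrA -signr_odd -[in RHS]signr_odd.
have -> : ((-1) ^+ odd (inversions lt v s) *
   ('X_(enum_rank v) * c (v |: s)) : S)@_(b - indicator s)
   = (-1) ^+ odd (inversions lt v s) *
   ('X_(enum_rank v) * c (v |: s) : S)@_(b - indicator s).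
  by case: odd; rewrite ?expr0 ?expr1 ?mul1r ?mulN1r // mcoeffN.
congr (_ * _); rewrite mcoeffMXU indicatorU1 // -lep1mP.
have -> : (U_(enum_rank v) + indicator s <= b)%MM =
          (U_(enum_rank v) <= b - indicator s)%MM.
  apply/mnm_lepP/mnm_lepP => le i; have := le i; move/mnm_lepP: sb => /(_ i);
    by rewrite mnmDE mnmBE => ib; rewrite leq_subRL // addnC.
by case: ifP => // _; rewrite submDA addmC.
Qed.

Lemma strand_inj c c' :
  (forall b, strand b c =1 strand b c') -> c =1 c'.
Proof.
move=> cc' s; apply/mpolyP => m; have := cc' (m + indicator s)%MM s.
by rewrite /strand lem_addl addmK.
Qed.

Variable U : mon -> Prop.

(* Koszul chains of total degree [d] with coefficients in the monomial ideal
   spanned by the monomials in [U]. *)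
Definition monomial_chain (d : int) (p : nat) (c : {set V} -> S^o) : Prop :=
  forall s m, (c s : S)@_m != 0 ->
    [/\ U m, (mdeg m + #|s|)%N%:Z = d & #|s| = p].

(** When [U] is the set of monomials of an ideal, this is its upper Koszul simplicial complex in
    multidegree [b]. *)
Definition upper_koszul (b : mon) (s : {set V}) : Prop :=
  (indicator s <= b)%MM /\ U (b - indicator s).

Lemma strand_chain d p c b :
  monomial_chain d p c -> simplicial_chain (upper_koszul b) p (strand b c).
Proof.
move=> Cc s; rewrite /strand; case: ifP => [sb /Cc[Us _ cs] //|].
by rewrite eqxx.
Qed.

(** The coefficient of the monomial [m] at [s] is read off in multidegree [m + indicator s];
    bounding the total degree by [d] leaves finitely many monomials, so polynomials result. *)
Lemma strand_lift d p (g : mon -> {set V} -> K^o) :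
  (forall b, simplicial_chain (upper_koszul b) p (g b)) ->
  (forall b s, (mdeg b)%:Z <> d -> g b s = 0) ->
  exists2 c, monomial_chain d p c & forall b, strand b c =1 g b.
Proof.
move=> Cg g0; pose h s (m : mon) : K := g (m + indicator s)%MM s.
have hd s m : h s m != 0 -> (mdeg m + #|s|)%N%:Z = d.
  move=> hm; rewrite -mdeg_indicator -mdegD.
  by apply/eqP; apply: contraNT hm => /eqP/g0 E; rewrite /h E.
have hk s m : h s m != 0 -> (mdeg m < `|d|.+1)%N.
  by move=> /hd <-; rewrite /=; lia.
pose c s : S^o := sval (mpoly_of_coefs (hk s)).
have cE s m : (c s : S)@_m = h s m by rewrite /c; case: mpoly_of_coefs.
exists c => [s m|b s].
  rewrite cE => hm; have := hd _ _ hm; move/Cg: hm => [[_]].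
  by rewrite addmK.
rewrite /strand cE /h; case: ifPn => sb; first by rewrite submK.
by have [//|/Cg[[]]] := eqVneq (g b s) 0; rewrite (negPf sb).
Qed.

Lemma monomial_boundary d p c : monomial_chain d p c ->
  (forall b, (mdeg b)%:Z = d ->
     exists2 g, simplicial_chain (upper_koszul b) p.+1 g &
                bd g =1 strand b c) ->
  exists2 y, monomial_chain d p.+1 y & kd y =1 c.
Proof.
move=> Cc ex.
have ex' b : exists g, simplicial_chain (upper_koszul b) p.+1 g /\
    if (mdeg b)%:Z == d then bd g =1 strand b c else g =1 (fun=> 0).
  case: eqP => [/ex[g ? ?]|_]; first by exists g.
  by exists (fun=> 0); split=> // s; rewrite eqxx.
have [g gP] := functional_choice ex'.
have [b|b s /eqP bd0|y Cy yg] := @strand_lift d p.+1 g.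
- by have [] := gP b.
- by have [_] := gP b; rewrite (negPf bd0) => ->.
exists y => //; apply: strand_inj => b s; rewrite strand_koszul.
rewrite (eq_koszul _ _ (yg b)); have [_] := gP b.
case: eqP => [_ -> //|bd0 gb]; rewrite koszul_eq0 //.
rewrite /strand; case: ifP => // sb.
have [->//|/Cc[_]] := eqVneq (c s : S)@_(b - indicator s) 0.
by rewrite -mdeg_indicator -mdegD submK.
Qed.

(** The Koszul complex in degree [d] is the direct sum of its strands; a cycle of one strand is
    extended by zero to the others. *)
Lemma homology_strand d p :
  homology_nonzero lt (W := S^o) vars (monomial_chain d) p <->
  exists2 b, (mdeg b)%:Z = d & simplicial_nonzero K lt (upper_koszul b) p.
Proof.
split=> [[c [Cc dc nbc]]|[b bd [f [Cf df nbf]]]].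
  apply: NNPP => nex; apply: nbc; apply: monomial_boundary => // b bd.
  apply: NNPP => nb; apply: nex; exists b => //.
  exists (strand b c); split=> [|s|//]; first exact: strand_chain Cc.
  by rewrite -strand_koszul /strand dc mcoeff0 if_same.
pose g b' : {set V} -> K^o := if b' == b then f else fun=> 0.
have [b'|b' s b'd|c Cc cg] := @strand_lift d p g.
- by rewrite /g; case: eqP => [->//|_ s]; rewrite eqxx.
- by rewrite /g; case: eqP => // b'b; rewrite b'b in b'd.
exists c; split=> // [|[y Cy yc]].
  apply: strand_inj => b' s; rewrite strand_koszul (eq_koszul _ _ (cg b')).
  rewrite [RHS]/strand mcoeff0 if_same /g.
  by case: eqP => _; rewrite ?df // koszul_eq0.
apply: nbf; exists (strand b y); first exact: strand_chain Cy.
move=> s; rewrite -strand_koszul -[RHS](_ : strand b c s = _); last first.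
  by rewrite cg /g eqxx.
by rewrite /strand yc.
Qed.

End MonomialKoszul.

(** * Homogeneous components *)

Section Homogeneous.

Variables (K : fieldType) (N : nat).
Implicit Types (p q : {mpoly K[N]}) (d e : int).

Lemma zhomogP d p :
  reflect (forall m, p@_m != 0 -> (mdeg m)%:Z = d) (zhomog d p).
Proof.
apply: (iffP allP) => [h m pm|h m]; last by rewrite mcoeff_msupp => /h/eqP.
by apply/eqP/h; rewrite mcoeff_msupp.
Qed.

Lemma zhomog0 d : zhomog d (0 : {mpoly K[N]}).
Proof. by apply/zhomogP => m; rewrite mcoeff0 eqxx. Qed.

Lemma zhomogD d p q : zhomog d p -> zhomog d q -> zhomog d (p + q).
Proof.
move=> /zhomogP hp /zhomogP hq; apply/zhomogP => m; rewrite mcoeffD => pqm.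
have [p0|/hp//] := eqVneq p@_m 0; apply: hq; by rewrite p0 add0r in pqm.
Qed.

Lemma zhomogN d p : zhomog d p -> zhomog d (- p).
Proof.
by move=> /zhomogP hp; apply/zhomogP => m; rewrite mcoeffN oppr_eq0 => /hp.
Qed.

Lemma zhomog_sum (I : Type) (r : seq I) (Q : pred I) d
    (F : I -> {mpoly K[N]}) :
  (forall i, Q i -> zhomog d (F i)) -> zhomog d (\sum_(i <- r | Q i) F i).
Proof.
move=> hF; apply: (big_ind (fun p => zhomog d p)) => //; first exact: zhomog0.
by move=> p q; apply: zhomogD.
Qed.

Fact zcomp_subproof d p m :
  (if (mdeg m)%:Z == d then p@_m else 0) != 0 -> (mdeg m < msize p)%N.
Proof.
by case: ifP => _; rewrite ?eqxx // -mcoeff_msupp => /msize_mdeg_lt.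
Qed.

Definition zcomp d p : {mpoly K[N]} :=
  sval (mpoly_of_coefs (@zcomp_subproof d p)).

Lemma mcoeff_zcomp d p m :
  (zcomp d p)@_m = if (mdeg m)%:Z == d then p@_m else 0.
Proof. by rewrite /zcomp; case: mpoly_of_coefs. Qed.

Lemma zcomp_homog d p : zhomog d (zcomp d p).
Proof.
apply/zhomogP => m; rewrite mcoeff_zcomp.
by case: ifP => [/eqP//|_]; rewrite eqxx.
Qed.

Lemma zcomp_id d p : zhomog d p -> zcomp d p = p.
Proof.
move=> /zhomogP hp; apply/mpolyP => m; rewrite mcoeff_zcomp.
by case: eqP => // md; have [//|/hp] := eqVneq p@_m 0.
Qed.

Lemma zcompM d e p q : zhomog e q -> zcomp (d + e) (p * q) = zcomp d p * q.
Proof.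
move=> /zhomogP hq; apply/mpolyP => m; rewrite mcoeff_zcomp !mcoeffM.
case: ifP => mde; last first.
  rewrite big1 // => k /eqP mk; rewrite mcoeff_zcomp.
  have [->|/hq ke] := eqVneq q@_(k.2) 0; first by rewrite mulr0.
  by rewrite -(inj_eq (addIr e)) -ke -PoszD -mdegD -mk ke mde mul0r.
apply: eq_bigr => k /eqP mk; rewrite mcoeff_zcomp.
have [->|/hq ke] := eqVneq q@_(k.2) 0; first by rewrite !mulr0.
by rewrite -(inj_eq (addIr e)) -ke -PoszD -mdegD -mk ke mde.
Qed.

Lemma zcompD d p q : zcomp d (p + q) = zcomp d p + zcomp d q.
Proof.
apply/mpolyP => m; rewrite mcoeffD !mcoeff_zcomp mcoeffD.
by case: ifP => // _; rewrite addr0.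
Qed.

Lemma zcomp0 d : zcomp d 0 = 0.
Proof. exact/zcomp_id/zhomog0. Qed.

Lemma zcomp_sum (I : Type) (r : seq I) d (F : I -> {mpoly K[N]}) :
  zcomp d (\sum_(i <- r) F i) = \sum_(i <- r) zcomp d (F i).
Proof. exact: (big_morph _ (zcompD d) (zcomp0 d)). Qed.

Lemma zhomogM d e p q : zhomog d p -> zhomog e q -> zhomog (d + e) (p * q).
Proof.
move=> hp hq; rewrite -[p](zcomp_id hp) -(zcompM _ _ hq); exact: zcomp_homog.
Qed.

Lemma zhomogC (c : K) : zhomog 0 (c%:MP : {mpoly K[N]}).
Proof.
apply/zhomogP => m; rewrite mcoeffC.
case: (eqVneq m 0%MM) => [->|_]; first by rewrite mdeg0.
by rewrite mulr0 eqxx.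
Qed.

Lemma zhomogX (i : 'I_N) : zhomog 1 ('X_i : {mpoly K[N]}).
Proof.
apply/zhomogP => m; rewrite mcoeffX.
case: (eqVneq U_(i)%MM m) => [<-|_]; rewrite ?mdeg1 //.
by rewrite eqxx.
Qed.

Lemma zhomog_sign d k p : zhomog d p -> zhomog d ((-1) ^+ k * p).
Proof.
move=> hp; rewrite -signr_odd; case: odd; rewrite ?expr0 ?expr1 ?mul1r //.
by rewrite mulN1r; apply: zhomogN.
Qed.

Lemma zhomog_coef0 d p : zhomog d p -> d != 0 -> p@_0%MM = 0.
Proof.
move=> /zhomogP hp; apply: contraNeq => /hp; by rewrite mdeg0 => <-.
Qed.

(* Row vectors as elements of the graded free module with generators in
   degrees [t]. *)
Section Rows.

Variable r : nat.
Implicit Types (t : 'I_r -> int) (u v : 'rV[{mpoly K[N]}]_r).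

Definition row_homog t d u : Prop := forall a, zhomog (d - t a) (u 0 a).

Lemma row_homog0 t d : row_homog t d 0.
Proof. by move=> a; rewrite mxE zhomog0. Qed.

Lemma row_homogD t d u v :
  row_homog t d u -> row_homog t d v -> row_homog t d (u + v).
Proof. by move=> hu hv a; rewrite mxE zhomogD. Qed.

Lemma row_homogN t d u : row_homog t d u -> row_homog t d (- u).
Proof. by move=> hu a; rewrite mxE zhomogN. Qed.

Lemma row_homogZ t d e p u :
  zhomog e p -> row_homog t d u -> row_homog t (d + e) (p *: u).
Proof.
move=> hp hu a; rewrite mxE (_ : d + e - t a = e + (d - t a)); last by ring.
by apply: zhomogM.
Qed.

Definition row_comp t d u : 'rV[{mpoly K[N]}]_r :=
  \row_a zcomp (d - t a) (u 0 a).

Lemma row_comp_homog t d u : row_homog t d (row_comp t d u).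
Proof. by move=> a; rewrite mxE zcomp_homog. Qed.

Lemma row_comp_id t d u : row_homog t d u -> row_comp t d u = u.
Proof. by move=> hu; apply/rowP => a; rewrite mxE zcomp_id. Qed.

End Rows.

Definition mx_homog (r s : nat) (t : 'I_r -> int) (t' : 'I_s -> int)
    (G : 'M[{mpoly K[N]}]_(s, r)) : Prop :=
  forall a b, zhomog (t' a - t b) (G a b).

(** This allows a preimage of a homogeneous row under [G] to be replaced by its homogeneous
    component. *)
Lemma row_comp_mulmx (r s : nat) (t : 'I_r -> int) (t' : 'I_s -> int)
    (G : 'M[{mpoly K[N]}]_(s, r)) d w :
  mx_homog t t' G -> row_comp t d (w *m G) = row_comp t' d w *m G.
Proof.
move=> hG; apply/rowP => b; rewrite !mxE zcomp_sum; apply: eq_bigr => a _.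
by rewrite mxE -(zcompM _ _ (hG a b)) addrA subrK.
Qed.

Lemma row_homog_mulmx (r s : nat) (t : 'I_r -> int) (t' : 'I_s -> int)
    (G : 'M[{mpoly K[N]}]_(s, r)) d w :
  mx_homog t t' G -> row_homog t' d w -> row_homog t d (w *m G).
Proof.
move=> hG hw; rewrite -(row_comp_id hw) -(row_comp_mulmx _ _ hG).
exact: row_comp_homog.
Qed.

End Homogeneous.

(** * Koszul homology of graded submodules *)

Section KoszulHomology.

Variables (K : fieldType) (V : finType) (lt : rel V).
Hypothesis lt_tour : tournament lt.

Notation S := {mpoly K[#|V|]}.
Notation vars := (fun v : V => 'X_(enum_rank v) : S).
Notation kd := (koszul lt vars).

Lemma koszul_entry (r : nat) (c : {set V} -> 'rV[S]_r) s a :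
  kd c s 0 a = kd (fun t => c t 0 a : S^o) s.
Proof. by rewrite summxE; apply: eq_bigr => v _; rewrite mxE. Qed.

Lemma koszul_mulmx (r s : nat) (c : {set V} -> 'rV[S]_r) (G : 'M[S]_(r, s)) t :
  kd (fun t' => c t' *m G) t = kd c t *m G.
Proof.
by rewrite /koszul mulmx_suml; apply: eq_bigr => v _; rewrite scalemxAl.
Qed.

(** The basis element of [s] has degree [#|s|], so the coefficient has degree [d - #|s|] and the
    differential preserves [d]. *)
Definition koszul_chain (r : nat) (M : 'rV[S]_r -> Prop) (t : 'I_r -> int)
    (d : int) (p : nat) (c : {set V} -> 'rV[S]_r) : Prop :=
  forall s, [/\ M (c s), row_homog t (d - #|s|%:Z) (c s) &
                c s != 0 -> #|s| = p].

Definition koszul_nonzero (r : nat) (M : 'rV[S]_r -> Prop) (t : 'I_r -> int)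
    (d : int) (p : nat) : Prop :=
  homology_nonzero lt vars (koszul_chain M t d) p.

Record submodule (r : nat) (M : 'rV[S]_r -> Prop) : Prop := Submodule {
  submodule0 : M 0;
  submoduleD : forall u v, M u -> M v -> M (u + v);
  submoduleZ : forall p u, M u -> M (p *: u)
}.

Definition rowspan (r s : nat) (G : 'M[S]_(s, r)) (u : 'rV[S]_r) : Prop :=
  exists w, u = w *m G.

Definition kernel (r s : nat) (G : 'M[S]_(s, r)) (u : 'rV[S]_s) : Prop :=
  u *m G = 0.

Lemma submodule_rowspan (r s : nat) (G : 'M[S]_(s, r)) : submodule (rowspan G).
Proof.
split=> [|_ _ [u ->] [v ->]|p _ [u ->]]; first by exists 0; rewrite mul0mx.
  by exists (u + v); rewrite mulmxDl.
by exists (p *: u); rewrite scalemxAl.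
Qed.

Lemma submodule_kernel (r s : nat) (G : 'M[S]_(s, r)) : submodule (kernel G).
Proof.
split=> [|u v|p u]; rewrite /kernel ?mul0mx ?mulmxDl // -?scalemxAl.
  by move=> -> ->; rewrite addr0.
by move=> ->; rewrite scaler0.
Qed.

Lemma submodule_sum (r : nat) (M : 'rV[S]_r -> Prop) (I : Type) (q : seq I)
    (Q : pred I) (F : I -> 'rV[S]_r) :
  submodule M -> (forall i, Q i -> M (F i)) -> M (\sum_(i <- q | Q i) F i).
Proof. by case=> M0 MD _ MF; apply: (big_ind M). Qed.

Lemma submoduleB (r : nat) (M : 'rV[S]_r -> Prop) u v :
  submodule M -> M u -> M v -> M (u - v).
Proof.
by case=> _ MD MZ Mu Mv; apply: MD => //; rewrite -scaleN1r; apply: MZ.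
Qed.

Lemma koszul_chain_koszul (r : nat) (M : 'rV[S]_r -> Prop) t d p c :
  submodule M -> koszul_chain M t d p.+1 c -> koszul_chain M t d p (kd c).
Proof.
move=> modM Cc s; split.
- apply: submodule_sum => // v _; apply: submoduleZ => //.
  by have [] := Cc (v |: s).
- move=> a; rewrite koszul_entry; apply: zhomog_sum => v vs.
  rewrite /GRing.scale /= -mulrA; apply: zhomog_sign.
  rewrite (_ : d - _ - _ = 1 + (d - #|v |: s|%:Z - t a)); last first.
    by rewrite cardsU1 vs -[(true + _)%N]/(1 + #|s|)%N PoszD; ring.
  by apply: zhomogM; [apply: zhomogX | have [_ + _] := Cc (v |: s); apply].
- apply: contraNeq => sp; rewrite /koszul big1 // => v vs.
  have [->|ne0] := eqVneq (c (v |: s)) 0; first by rewrite scaler0.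
  have [_ _ /(_ ne0)] := Cc (v |: s).
  by rewrite cardsU1 vs add1n => -[cs]; rewrite cs eqxx in sp.
Qed.

Lemma koszul_chainB (r : nat) (M : 'rV[S]_r -> Prop) t d p c c' :
  submodule M -> koszul_chain M t d p c -> koszul_chain M t d p c' ->
  koszul_chain M t d p (fun s => c s - c' s).
Proof.
move=> modM Cc Cc' s; have [Mc hc sc] := Cc s; have [Mc' hc' sc'] := Cc' s.
split; first exact: submoduleB.
  by apply: row_homogD => //; apply: row_homogN.
have [->|/sc //] := eqVneq (c s) 0; by rewrite sub0r oppr_eq0.
Qed.

Lemma koszul_chain_sub (r : nat) (M M' : 'rV[S]_r -> Prop) t d p c :
  (forall u, M u -> M' u) -> koszul_chain M t d p c -> koszul_chain M' t d p c.
Proof. by move=> MM' Cc s; have [/MM' ? ? ?] := Cc s. Qed.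

(** The Koszul complex of a free module has homology only in homological degree 0, given by the
    constant terms; hence the extra condition for [p = 0]. The proof goes through each coordinate
    and each multidegree. *)
Lemma free_acyclic (r : nat) (t : 'I_r -> int) d p c :
  koszul_chain (fun=> True) t d p c -> kd c =1 (fun=> 0) ->
  (p = 0%N -> forall a, (c set0 0 a)@_0%MM = 0) ->
  exists2 y, koszul_chain (fun=> True) t d p.+1 y & kd y =1 c.
Proof.
move=> Cc dc c0.
have ex a : exists ya : {set V} -> S^o,
    monomial_chain (fun=> True) (d - t a) p.+1 ya /\
    koszul lt (W := S^o) vars ya =1 (fun s => c s 0 a).
  have Ca : monomial_chain (fun=> True) (d - t a) p (fun s => c s 0 a : S^o).
    move=> s m csm; have [_ /(_ a)/zhomogP/(_ _ csm) mE] := Cc s.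
    have cs0 : c s != 0.
      by apply: contraNneq csm => ->; rewrite mxE mcoeff0.
    move=> /(_ cs0) cs; split=> //; rewrite PoszD mE; ring.
  have [b _|ya Cya dya] := @monomial_boundary _ _ lt _ _ _ _ Ca;
    last by exists ya.
  (* In multidegree 0 only the empty face occurs, with a constant coefficient: it vanishes by [c0]
     if [p = 0], and otherwise because of its cardinality. *)
  have [b0|/eqP b0] := eqVneq b 0%MM.
    have st0 : strand b (fun s => c s 0 a : S^o) =1 (fun=> 0).
      move=> s; rewrite /strand b0; case: ifP => // sb.
      have s0 : s = set0.
        apply/setP => v; rewrite inE; move/lem_rankP: sb => /(_ v).
        by rewrite indicatorE mnm0E leqn0; case: (v \in s).
      rewrite sub0m; have [//|csm] := eqVneq (c s 0 a)@_0%MM 0.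
      have [_ _ cs] := Ca _ _ csm; rewrite s0 cards0 in cs.
      by rewrite s0 c0 // eqxx in csm.
    exists (fun=> 0) => s; first by rewrite eqxx.
    by rewrite koszul_eq0 ?st0.
  have [u bu] : exists u, b (enum_rank u) != 0%N.
    apply: NNPP => nex; apply: b0; apply: mnm_rankP => v; rewrite mnm0E.
    by apply/eqP/negPn/negP => bv; apply: nex; exists v.
  apply: (@cone_acyclic _ _ _ lt_tour u) => [s [sb _]||s].
  - split=> //; apply/lem_rankP => v; rewrite indicatorE in_setU1.
    case: eqVneq => [->|_] /=; first by rewrite lt0n.
    by have/lem_rankP/(_ v) := sb; rewrite indicatorE.
  - exact: strand_chain Ca.
  - by rewrite -strand_koszul /strand -koszul_entry dc mxE mcoeff0 if_same.
have [y yP] := functional_choice ex.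
exists (fun s => \row_a (y a s : S)) => s.
  split=> // [a|].
    rewrite mxE; apply/zhomogP => m ym; have [Cy _] := yP a.
    by have [_ + _] := Cy _ _ ym; lia.
  move=> ne0; apply: NNPP => cs; case/eqP: ne0; apply/rowP => a.
  rewrite !mxE; apply/mpolyP => m; rewrite mcoeff0; apply/eqP/negPn/negP => ym.
  by have [Cy _] := yP a; have [_ _ /cs] := Cy _ _ ym.
apply/rowP => a; have [_ <-] := yP a.
rewrite koszul_entry; apply: (@eq_koszul V lt S S^o vars) => s1; by rewrite mxE.
Qed.

Section DimensionShift.

Variables (r s : nat) (t : 'I_r -> int) (t' : 'I_s -> int) (G : 'M[S]_(s, r)).
Hypothesis G_homog : mx_homog t t' G.

Lemma chain_mulmx d p y :
  koszul_chain (fun=> True) t' d p y ->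
  koszul_chain (rowspan G) t d p (fun s => y s *m G).
Proof.
move=> Cy x; have [_ hy sy] := Cy x; split; first by exists (y x).
  exact: row_homog_mulmx hy.
by have [->|/sy //] := eqVneq (y x) 0; rewrite mul0mx eqxx.
Qed.

Lemma chain_lift d p c : koszul_chain (rowspan G) t d p c ->
  exists2 y, koszul_chain (fun=> True) t' d p y & forall x, c x = y x *m G.
Proof.
move=> Cc.
have ex x : exists w, [/\ c x = w *m G, row_homog t' (d - #|x|%:Z) w &
    w != 0 -> #|x| = p].
  have [[w cw] hc sc] := Cc x.
  have [cx0|/sc cx] := eqVneq (c x) 0.
    exists 0; split; rewrite ?mul0mx ?eqxx //; exact: row_homog0.
  exists (row_comp t' (d - #|x|%:Z) w); split=> //.
    by rewrite -(row_comp_mulmx _ _ G_homog) -cw row_comp_id.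
  exact: row_comp_homog.
have [y yP] := functional_choice ex.
by exists y => x; have [] := yP x.
Qed.

Hypothesis G_minimal :
  forall w, kernel G w -> forall a, (w 0 a)@_0%MM = 0.

(** This is the connecting homomorphism for the kernel, the free module and the image of [G]: the
    free module has no homology in positive degree, and by minimality the kernel maps to zero in its
    homology in degree 0. *)
Lemma koszul_shift d p :
  koszul_nonzero (rowspan G) t d p.+1 <-> koszul_nonzero (kernel G) t' d p.
Proof.
have modG := submodule_rowspan G; have modN := submodule_kernel G.
have modT : submodule (fun _ : 'rV[S]_s => True) by [].
split=> [[c [Cc dc nbc]]|[z [Cz dz nbz]]].
  have [y Cy yc] := chain_lift Cc.
  have dyG x : kernel G (kd y x).
    rewrite /kernel -koszul_mulmx -[RHS](dc x).
    by apply: eq_koszul => x'; rewrite yc.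
  have Cdy : koszul_chain (kernel G) t' d p (kd y).
    by move=> x; have [_ ? ?] := koszul_chain_koszul modT Cy x.
  exists (kd y); split=> // [x|[n Cn dn]]; first exact: koszul_koszul.
  (* If [kd y] is also the boundary of [n] in the kernel, then [y - n] is a cycle of the free module
     in positive homological degree, hence a boundary. *)
  have [x|||w Cw dw] // := @free_acyclic _ t' d p.+1 (fun x => y x - n x).
  - by have [] := koszul_chainB modT Cy (koszul_chain_sub _ Cn) x.
  - by move=> x; rewrite koszulD koszulN dn subrr.
  apply: nbc; exists (fun x => w x *m G); first exact: chain_mulmx.
  move=> x; rewrite koszul_mulmx dw mulmxBl -yc.
  by have [-> _ _] := Cn x; rewrite subr0.
have CzT : koszul_chain (fun=> True) t' d p z by apply: koszul_chain_sub Cz.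
(* For [p = 0] minimality supplies the vanishing constant terms. *)
have [p0 a|y Cy yz] := free_acyclic CzT dz.
  by apply: G_minimal; have [] := Cz set0.
exists (fun x => y x *m G); split=> [|x|[b Cb db]]; first exact: chain_mulmx.
  by rewrite koszul_mulmx yz; have [-> _ _] := Cz x.
have [w Cw wb] := chain_lift Cb.
apply: nbz; exists (fun x => y x - kd w x) => x.
  have [_ ? ?] := koszul_chainB modT Cy (koszul_chain_koszul modT Cw) x.
  split=> //; rewrite /kernel mulmxBl -db -koszul_mulmx.
  by rewrite (eq_koszul _ _ wb) subrr.
by rewrite koszulD koszulN koszul_koszul // oppr0 addr0 yz.
Qed.

(** Homology in degree 0 is the module modulo the multiples of the variables; by minimality the rows
    of [G] give a basis of it over [K]. *)
Lemma koszul_generators d :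
  koszul_nonzero (rowspan G) t d 0 <-> exists a, t' a = d.
Proof.
have modT : submodule (fun _ : 'rV[S]_s => True) by [].
split=> [[c [Cc dc nbc]]|[a ad]].
  have [y Cy yc] := chain_lift Cc; apply: NNPP => nex; apply: nbc.
  have dy0 x : kd y x = 0.
    rewrite /koszul big1 // => v vx; have [-> |ne0] := eqVneq (y (v |: x)) 0.
      by rewrite scaler0.
    by have [_ _ /(_ ne0)] := Cy (v |: x); rewrite cardsU1 vx.
  (* If [d] is not a twist, every coefficient has nonzero degree and so no constant term. *)
  have [_ a|w Cw wy] := @free_acyclic _ t' d 0 y Cy dy0.
    have [_ /(_ a) + _] := Cy set0.
    rewrite cards0 subr0 => /zhomog_coef0; apply.
    by rewrite subr_eq0; apply/eqP => E; apply: nex; exists a.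
  exists (fun x => w x *m G); first exact: chain_mulmx.
  by move=> x; rewrite koszul_mulmx wy yc.
pose e : 'rV[S]_s := delta_mx 0 a.
have he : row_homog t' d e.
  move=> b; rewrite mxE eqxx /=; case: eqP => [->|_]; last exact: zhomog0.
  by rewrite ad subrr -mpolyC1; apply: zhomogC.
pose y x := if x == set0 :> {set V} then e else 0.
have Cy : koszul_chain (fun=> True) t' d 0 y.
  move=> x; rewrite /y; case: eqP => [->|_]; split=> //.
  - by rewrite cards0 subr0.
  - by rewrite cards0.
  - exact: row_homog0.
  - by rewrite eqxx.
exists (fun x => y x *m G); split=> [|x|[b Cb db]]; first exact: chain_mulmx.
  rewrite koszul_mulmx /koszul big1 ?mul0mx // => v _.
  rewrite /y ifN ?scaler0 //; apply/set0Pn; exists v; exact: setU11.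
have [w Cw wb] := chain_lift Cb.
have := db set0; rewrite (eq_koszul _ _ wb) koszul_mulmx /y eqxx => E.
(* If generator [a] were a combination of multiples of the variables, this relation would have
   constant coefficient 1 at [a]. *)
have /G_minimal/(_ a) : kernel G (e - kd w set0).
  by rewrite /kernel mulmxBl E subrr.
rewrite !mxE !eqxx koszul_entry mcoeffB mcoeff1 eqxx raddf_sum /= big1 ?subr0.
  by move/eqP; rewrite oner_eq0.
move=> v _; rewrite /GRing.scale /= -mulrA mulrCA mcoeffMXU mnm0E //.
Qed.

End DimensionShift.

End KoszulHomology.

(** * Betti numbers and Koszul homology *)

Section Resolutions.

Variables (K : fieldType) (V : finType) (lt : rel V).
Hypothesis lt_tour : tournament lt.

Notation S := {mpoly K[#|V|]}.

Lemma eq_koszul_nonzero (r : nat) (M M' : 'rV[S]_r -> Prop) t d p :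
  (forall u, M u <-> M' u) ->
  koszul_nonzero lt M t d p <-> koszul_nonzero lt M' t d p.
Proof.
move=> MM'; have MM'1 u : M u -> M' u by case: (MM' u).
have MM'2 u : M' u -> M u by case: (MM' u).
split=> -[c [Cc dc nb]]; exists c;
  (split=> //; first exact: koszul_chain_sub Cc).
  case=> b Cb db; apply: nb; exists b => //; exact: koszul_chain_sub Cb.
case=> b Cb db; apply: nb; exists b => //; exact: koszul_chain_sub Cb.
Qed.

Definition ideal_row (I : S -> Prop) (u : 'rV[S]_1) : Prop := I (u 0 0).

(** Koszul homology of the variables computes Tor of [I] with the residue field. *)
Definition tor_nonzero (I : S -> Prop) (i : nat) (j : int) : Prop :=
  koszul_nonzero lt (ideal_row I) (fun=> 0) j i.

Lemma mcoeff0_mulmx (r s : nat) (w : 'rV[S]_s) (G : 'M[S]_(s, r)) :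
  (forall a b, (G a b)@_0%MM = 0) -> forall b, ((w *m G) 0 b)@_0%MM = 0.
Proof.
move=> G0 b; rewrite mxE raddf_sum big1 //= => a _.
by rewrite rmorphM /= G0 mulr0.
Qed.

Section Twists.

Variables (I : S -> Prop) (F : min_free_resolution I).

Let augm_min w : kernel (augm F) w -> forall a, (w 0 a)@_0%MM = 0.
Proof.
by move=> /exact_augm[v ->] a; apply: mcoeff0_mulmx => ? ?; apply: diff_minimal.
Qed.

Let diff_min i w : kernel (diff F i) w -> forall a, (w 0 a)@_0%MM = 0.
Proof.
by move=> /exact_diff[v ->] a; apply: mcoeff0_mulmx => ? ?; apply: diff_minimal.
Qed.

Let augm_mx_homog : mx_homog (fun=> 0) (@twist _ _ _ F 0%N) (augm F).
Proof. by move=> a b; rewrite subr0 ord1; apply: augm_homog. Qed.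

Let tor_augm i j :
  tor_nonzero I i j <-> koszul_nonzero lt (rowspan (augm F)) (fun=> 0) j i.
Proof.
apply: eq_koszul_nonzero => u; rewrite /ideal_row.
split=> [/(augm_image F)[w uw]|[w ->]]; last by apply/(augm_image F); exists w.
by exists w; apply/rowP => b; rewrite ord1.
Qed.

(** Iterated dimension shift: the image of [diff i] is the syzygy module of order [i.+1]. *)
Let tor_diff i j p : tor_nonzero I (p + i.+1) j <->
  koszul_nonzero lt (rowspan (diff F i)) (@twist _ _ _ F i) j p.
Proof.
elim: i p => [|i IHi] p.
  rewrite addn1 tor_augm (koszul_shift lt_tour augm_mx_homog augm_min).
  exact/eq_koszul_nonzero/exact_augm.
rewrite addnS -addSn IHi.
rewrite (koszul_shift lt_tour (@diff_homog _ _ _ F i) (@diff_min i)).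
exact/eq_koszul_nonzero/exact_diff.
Qed.

Lemma twist_tor i j : (exists a, @twist _ _ _ F i a = j) <-> tor_nonzero I i j.
Proof.
case: i => [|i].
  by rewrite tor_augm (koszul_generators lt_tour augm_mx_homog augm_min).
rewrite -[i.+1]add0n tor_diff add0n.
by rewrite (koszul_generators lt_tour (@diff_homog _ _ _ F i) (@diff_min i)).
Qed.

End Twists.

(** [betti] is a chosen value, meaningful once a resolution exists; by [twist_tor] every resolution
    gives the same nonvanishing. *)
Lemma betti_tor (I : S -> Prop) i j :
  inhabited (min_free_resolution I) -> betti I i j <> 0%N <-> tor_nonzero I i j.
Proof.
case=> F0; rewrite /betti; have [|F ->] := epsilon_spec (inhabits 0%N) (fun b =>
    exists F : min_free_resolution I, b = #|[set a | @twist _ _ _ F i a == j]|).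
  by exists #|[set a | @twist _ _ _ F0 i a == j]|, F0.
rewrite -(twist_tor F); split=> [/eqP|[a aj]].
  by rewrite cards_eq0 => /set0Pn[a]; rewrite inE => /eqP; exists a.
by apply/eqP; rewrite cards_eq0; apply/set0Pn; exists a; rewrite inE aj.
Qed.

End Resolutions.

(** * Minimal homogeneous generators *)

Lemma ex_minimal_nat (P : nat -> Prop) :
  (exists n, P n) -> exists n, P n /\ forall k, P k -> (n <= k)%N.
Proof.
case=> n; elim/ltn_ind: n => n IHn Pn.
case: (classic (exists2 k, P k & (k < n)%N)) => [[k Pk kn]|nex].
  exact: IHn kn Pk.
exists n; split=> // k Pk; rewrite leqNgt; apply/negP => kn.
by apply: nex; exists k.
Qed.

Section Existence.

Variables (K : fieldType) (V : finType) (lt : rel V).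
Hypothesis lt_tour : tournament lt.

Notation S := {mpoly K[#|V|]}.
Notation mon := 'X_{1..#|V|}.

(** The coefficients listed in [Q] are finitely many functionals that separate the points of [W].
    Each of them costs at most one generator beyond those of the subspace where it vanishes. *)
Lemma finite_dim_rowspan (r : nat) (W : 'rV[S]_r -> Prop)
    (Q : seq ('I_r * mon)) :
  (forall c u v, W u -> W v -> W (u - c%:MP *: v)) ->
  (forall u, W u -> (forall q, q \in Q -> (u 0 q.1)@_(q.2) = 0) -> u = 0) ->
  exists s (G : 'M[S]_(s, r)),
    (forall a, W (row a G)) /\ (forall u, W u -> rowspan G u).
Proof.
elim: Q W => [|q Q IHQ] W WB Winj.
  exists 0%N, 0; split=> [[]//|u Wu]; exists 0; rewrite mul0mx; exact: Winj.
have [c u v [Wu u0] [Wv v0]|u [Wu u0] uQ|s [G [GW WG]]] :=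
  IHQ (fun u => W u /\ (u 0 q.1)@_(q.2) = 0).
- by split; [apply: WB | rewrite !mxE mcoeffB mcoeffCM u0 v0 mulr0 subrr].
- apply: Winj => // q'; rewrite inE => /orP[/eqP ->|/uQ] //.
case: (classic (exists w, W w /\ (w 0 q.1)@_(q.2) <> 0)) => [[w [Ww w0]]|nex].
  exists (s + 1)%N, (col_mx G w); split=> [a|u Wu].
    case: (split_ordP a) => b ->; first by rewrite rowKu; case: (GW b).
    by rewrite rowKd ord1 row_id.
  pose c : K := (u 0 q.1)@_(q.2) / (w 0 q.1)@_(q.2).
  have [|x ux] := WG (u - c%:MP *: w).
    split; first exact: WB.
    by rewrite !mxE mcoeffB mcoeffCM divfK ?subrr //; apply/eqP.
  exists (row_mx x c%:MP%:M); rewrite mul_row_col -ux mul_scalar_mx.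
  by rewrite subrK.
exists s, G; split=> [a|u Wu]; first by case: (GW a).
by apply: WG; split=> //; apply: NNPP => ne; apply: nex; exists u.
Qed.

Section Graded.

Variables (r : nat) (t : 'I_r -> int) (M : 'rV[S]_r -> Prop).
Hypothesis modM : submodule M.
Hypothesis M_graded : forall d u, M u -> M (row_comp t d u).

(** All twists lie between [-B] and [B], so a nonzero homogeneous row has degree at least [-B]. *)
Let B : nat := (\sum_a `|t a|)%N.

Let t_bound a : (- B%:Z <= t a) && (t a <= B%:Z).
Proof.
have : (`|t a| <= B)%N by rewrite /B (bigD1 a) //= leq_addr.
lia.
Qed.

Let homog_low d (u : 'rV[S]_r) : row_homog t d u -> d < - B%:Z -> u = 0.
Proof.
move=> hu dB; apply/rowP => a; rewrite mxE; apply/mpolyP => m; rewrite mcoeff0.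
apply/eqP/negPn/negP => um; have /zhomogP/(_ _ um) := hu a.
have := t_bound a; lia.
Qed.

Let degree_gens d : exists s (G : 'M[S]_(s, r)),
  [/\ mx_homog t (fun=> d) G, (forall a, M (row a G)) &
      forall u, M u -> row_homog t d u -> rowspan G u].
Proof.
(* A monomial at position [a] of a row of degree [d] has degree [d - t a], which is less than
   [E]. *)
pose E := (`|d| + B).+1.
pose Q := [seq (a, bmnm m) | a <- enum 'I_r, m <- enum {: 'X_{1..#|V| < E}}].
have [c u v [Mu hu] [Mv hv]|u [Mu hu] uQ|s [G [GW WG]]] :=
  @finite_dim_rowspan r (fun u => M u /\ row_homog t d u) Q.
- split; first by apply: submoduleB => //; apply: submoduleZ.
  apply: row_homogD => //; apply: row_homogN; rewrite -[d]addr0.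
  by apply: row_homogZ => //; apply: zhomogC.
- apply/rowP => a; rewrite mxE; apply/mpolyP => m; rewrite mcoeff0.
  apply/eqP/negPn/negP => um; have /zhomogP/(_ _ um) md := hu a.
  have mE : (mdeg m < E)%N by have := t_bound a; rewrite /E; lia.
  have := uQ (a, m); rewrite /= => um0; case/eqP: um; apply: um0.
  by apply/allpairsP; exists (a, BMultinom mE); rewrite !mem_enum.
exists s, G; split=> [a b|a|u Mu hu]; last exact: WG.
  by have [_ /(_ b)] := GW a; rewrite mxE.
by case: (GW a).
Qed.

Let range_gens n : exists s (t' : 'I_s -> int) (G : 'M[S]_(s, r)),
  [/\ mx_homog t t' G, (forall a, M (row a G)) &
      forall d u, d < - B%:Z + n%:Z -> M u -> row_homog t d u -> rowspan G u].
Proof.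
elim: n => [|n [s1 [t1 [G1 [hG1 MG1 span1]]]]].
  exists 0%N, (fun=> 0), 0; split=> [[]//|[]//|d u].
  by rewrite addr0 => dB _ hu; exists 0; rewrite mul0mx (homog_low hu).
have [s2 [G2 [hG2 MG2 span2]]] := degree_gens (- B%:Z + n%:Z).
pose t' (a : 'I_(s1 + s2)) :=
  match split a with inl b => t1 b | inr _ => - B%:Z + n%:Z end.
exists (s1 + s2)%N, t', (col_mx G1 G2); split=> [a b|a|d u dn Mu hu].
- by rewrite mxE /t'; case: split.
- by case: (split_ordP a) => b ->; rewrite ?rowKu ?rowKd.
have [dE|dE] := eqVneq d (- B%:Z + n%:Z).
  rewrite dE in hu; have [w ->] := span2 _ Mu hu.
  by exists (row_mx 0 w); rewrite mul_row_col mul0mx add0r.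
have [|w ->] := span1 d u _ Mu hu; first by lia.
by exists (row_mx w 0); rewrite mul_row_col mul0mx addr0.
Qed.

Let sum_comp (u : 'rV[S]_r) :
  exists n, u = \sum_(k < n) row_comp t (- B%:Z + k%:Z) u.
Proof.
(* Monomials of [u] have degree less than [E] and twists are at most [B]; the second [B] accounts
   for counting degrees from [-B]. *)
pose E := (\sum_a msize (u 0%R a))%N; exists (E + B + B)%N; apply/rowP => a.
rewrite summxE; apply/mpolyP => m; rewrite raddf_sum /=.
under eq_bigr do rewrite mxE mcoeff_zcomp.
have [um|um] := eqVneq (u 0 a)@_m 0.
  by rewrite big1 ?um // => k _; rewrite if_same.
have mE : (mdeg m < E)%N.
  have um_size : (mdeg m < msize (u 0%R a))%N.
    by apply: msize_mdeg_lt; rewrite mcoeff_msupp.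
  by apply: leq_trans um_size _; rewrite /E (bigD1 a) //= leq_addr.
pose k0 := absz ((mdeg m)%:Z + t a + B%:Z).
have k0P : k0%:Z = (mdeg m)%:Z + t a + B%:Z.
  by rewrite /k0 gez0_abs //; have := t_bound a; lia.
have k0E : (k0 < E + B + B)%N by have := t_bound a; move: k0P mE; lia.
rewrite (bigD1 (Ordinal k0E)) //= big1 ?addr0 => [|k kk0].
  by rewrite ifT // k0P; apply/eqP; ring.
rewrite ifN //; apply: contra kk0 => /eqP mk; apply/eqP/val_inj => /=.
by apply/eqP; rewrite -eqz_nat k0P mk; apply/eqP; ring.
Qed.

Variable D : int.
Hypothesis no_gens : forall d, D < d -> ~ koszul_nonzero lt M t d 0.

(** Graded Nakayama argument: above degree [D] every element is a combination of variables times
    elements of degree one less, so induction reaches degree [D]. *)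
Let homog_span (s : nat) (G : 'M[S]_(s, r)) :
  (forall d u, d <= D -> M u -> row_homog t d u -> rowspan G u) ->
  forall d u, M u -> row_homog t d u -> rowspan G u.
Proof.
move=> spanD d; have [n] : exists n : nat, d <= D + n%:Z.
  by exists (absz (d - D)); lia.
elim: n d => [|n IHn] d dn u Mu hu; first by apply: spanD hu => //; lia.
have [dD|Dd] := lerP d D; first exact: spanD hu.
apply: NNPP => nspan; apply: (no_gens Dd).
pose c x := if x == set0 :> {set V} then u else 0.
exists c; split=> [x|x|[b Cb bc]].
- rewrite /c; case: eqP => [->|_]; rewrite ?cards0 ?subr0 ?eqxx; split=> //.
  + exact: submodule0.
  + exact: row_homog0.
- rewrite /koszul big1 // => v _; rewrite /c ifN ?scaler0 //.
  by apply/set0Pn; exists v; apply: setU11.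
apply: nspan; have := bc set0; rewrite /c eqxx => <-.
apply: submodule_sum => [|v _]; first exact: submodule_rowspan.
apply: (submoduleZ (submodule_rowspan G)).
have [Mb hb _] := Cb (v |: set0); apply: IHn hb => //.
rewrite setU0 cards1; lia.
Qed.

Lemma graded_finite_gens : exists s (t' : 'I_s -> int) (G : 'M[S]_(s, r)),
  mx_homog t t' G /\ forall u, M u <-> rowspan G u.
Proof.
(* The range starts at [-B], and this length makes it include every degree up to [D]. *)
have [s [t' [G [hG MG span]]]] := range_gens (absz (D + B%:Z + 1)).
exists s, t', G; split=> // u; split=> [Mu|[w ->]]; last first.
  by rewrite mulmx_sum_row; apply: submodule_sum => // a _; apply: submoduleZ.
have [n ->] := sum_comp u.
apply: submodule_sum => [|k _]; first exact: submodule_rowspan.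
apply: homog_span (M_graded _ Mu) (row_comp_homog _ _ _) => d v dD.
by apply: span; lia.
Qed.

(** A homogeneous generating family with the least number of elements is taken; a relation with a
    nonzero constant coefficient would allow one generator to be dropped. *)
Lemma minimal_gens : exists s (t' : 'I_s -> int) (G : 'M[S]_(s, r)),
  [/\ mx_homog t t' G, forall u, M u <-> rowspan G u &
      forall w, kernel G w -> forall a, (w 0 a)@_0%MM = 0].
Proof.
have [s [[t' [G [hG MG]]] s_min]] := ex_minimal_nat graded_finite_gens.
exists s, t', G; split=> // w0 kw0 a; apply: NNPP => /eqP w0a.
case: s => [|s] in t' G hG MG s_min w0 kw0 a w0a *; first by case: a w0a.
(* In the relation [w] of degree [t' a] the coefficient of generator [a] is a
   nonzero constant, so that this generator is redundant. *)
pose w := row_comp t' (t' a) w0.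
have kw : w *m G = 0.
  rewrite -(row_comp_mulmx _ _ hG) kw0; apply: row_comp_id; exact: row_homog0.
pose c : K := (w0 0 a)@_0%MM.
have wa : w 0 a = c%:MP.
  rewrite mxE subrr; apply/mpolyP => m; rewrite mcoeff_zcomp mcoeffC.
  have -> : ((mdeg m)%:Z == 0) = (m == 0%MM) by rewrite -mdeg_eq0.
  by case: eqP => [->|_]; rewrite ?mulr1 ?mulr0.
clearbody w; suff : (s.+1 <= s)%N by rewrite ltnn.
apply: s_min; exists (t' \o lift a), (row' a G); split=> [b b'|u].
  by rewrite mxE; apply: hG.
rewrite MG; split=> -[v ->].
  (* Subtracting a multiple of the relation [w] clears coordinate [a] without changing the
     combination. *)
  pose v1 := v - (v 0 a * (c^-1)%:MP) *: w.
  have v1a : v1 0 a = 0.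
    by rewrite !mxE wa -mulrA -mpolyCM mulVf // mulr1 subrr.
  have -> : v *m G = v1 *m G.
    by rewrite mulmxBl -scalemxAl kw scaler0 subr0.
  exists (col' a v1); apply/rowP => b; rewrite !mxE (bigD1_ord a) //= v1a mul0r.
  by rewrite add0r; apply: eq_bigr => b' _; rewrite !mxE.
exists (\row_b if unlift a b is Some b' then v 0 b' else 0).
apply/rowP => b; rewrite !mxE (bigD1_ord a) //= mxE unlift_none mul0r add0r.
by apply: eq_bigr => b' _; rewrite !mxE liftK.
Qed.

End Graded.

End Existence.

(** * Existence of minimal free resolutions *)

Section ResolutionExistence.

Variables (K : fieldType) (V : finType) (lt : rel V).
Hypothesis lt_tour : tournament lt.

Notation S := {mpoly K[#|V|]}.

Variable D : int.

Record stage := Stage {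
  source : nat;
  target : nat;
  source_twist : 'I_source -> int;
  target_twist : 'I_target -> int;
  stage_mx : 'M[S]_(source, target)
}.

(** This is the invariant of the iteration. Dimension shifting lowers the homological degree and
    keeps the internal degree, so one bound [D] serves all syzygy modules, provided the vanishing is
    required for every [p]. *)
Definition minimal_stage (st : stage) : Prop :=
  [/\ mx_homog (@target_twist st) (@source_twist st) (stage_mx st),
      (forall w, kernel (stage_mx st) w -> forall a, (w 0 a)@_0%MM = 0) &
      forall d p, D < d ->
        ~ koszul_nonzero lt (kernel (stage_mx st)) (@source_twist st) d p].

Lemma minimal_cover (r : nat) (t : 'I_r -> int) (M : 'rV[S]_r -> Prop) :
  submodule M -> (forall d u, M u -> M (row_comp t d u)) ->
  (forall d p, D < d -> ~ koszul_nonzero lt M t d p) ->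
  exists y : {s : nat & (('I_s -> int) * 'M[S]_(s, r))%type},
    minimal_stage (Stage (tagged y).1 t (tagged y).2) /\
    (forall u, M u <-> rowspan (tagged y).2 u).
Proof.
move=> modM grM vanM.
have [s [t' [G [hG MG Gmin]]]] :=
  minimal_gens modM grM (fun d => @vanM d 0%N).
exists (existT _ s (t', G)); split=> //; split=> //= d p Dd.
rewrite -(koszul_shift lt_tour hG Gmin).
by move/(eq_koszul_nonzero lt t d p.+1 MG)/(vanM _ _ Dd).
Qed.

Lemma kernel_cover (st : {st | minimal_stage st}) :
  exists y : {s : nat & (('I_s -> int) * 'M[S]_(s, source (sval st)))%type},
    minimal_stage (Stage (tagged y).1 (@source_twist (sval st)) (tagged y).2) /\
    (forall u, kernel (stage_mx (sval st)) u <-> rowspan (tagged y).2 u).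
Proof.
case: st => st /= [hst mst vst]; apply: minimal_cover => //.
  exact: submodule_kernel.
move=> d u; rewrite /kernel -(row_comp_mulmx _ _ hst) => ->.
by apply: row_comp_id; apply: row_homog0.
Qed.

Definition next_stage (st : {st | minimal_stage st}) :
    {st | minimal_stage st} :=
  let y := constructive_indefinite_description _ (kernel_cover st) in
  exist _ _ (proj1 (svalP y)).

Lemma next_stageP st u :
  kernel (stage_mx (sval st)) u <-> rowspan (stage_mx (sval (next_stage st))) u.
Proof.
exact: (proj2 (svalP
  (constructive_indefinite_description _ (kernel_cover st)))).
Qed.

Lemma resolution_exists (I : S -> Prop) :
  submodule (ideal_row I) ->
  (forall d p, I p -> I (zcomp d p)) ->
  (forall d p, D < d -> ~ tor_nonzero lt I p d) ->
  inhabited (min_free_resolution I).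
Proof.
move=> modI grI vanI.
have [|y [y_min yI]] := @minimal_cover 1 (fun=> 0) (ideal_row I) modI _
  (fun d p => vanI d p).
  by move=> d u Iu; rewrite /ideal_row mxE; apply: grI.
(* Stage 0 is the augmentation, and stage [i.+1] is [diff i]. *)
pose st i := iter i next_stage (exist _ _ y_min).
have st_min i : minimal_stage (sval (st i)) by apply: svalP.
constructor.
apply: (@MinFreeResolution _ _ _ (fun i => source (sval (st i)))
  (fun i => @source_twist (sval (st i))) (tagged y).2
  (fun i => stage_mx (sval (st i.+1)))) => [a|i a b|p|u|i u|i a b].
- by have [/(_ a 0) + _ _] := y_min; rewrite subr0.
- by case: (st_min i.+1) => /(_ a b).
- have -> : I p <-> ideal_row I (const_mx p) by rewrite /ideal_row mxE.
  rewrite yI; split=> -[w E]; exists w; first by rewrite -E mxE.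
  by apply/rowP => b; rewrite !ord1 -E mxE.
- exact: (@next_stageP (st 0%N)).
- exact: (@next_stageP (st i.+1)).
(* Each row of a differential lies in the kernel of the previous stage, whose elements have no
   constant terms. *)
have [_ /(_ (row a (stage_mx (sval (st i.+1))))) st_i _] := st_min i.
have := st_i _ b; rewrite mxE; apply; apply/(@next_stageP (st i)).
by exists (delta_mx 0 a); rewrite -rowE.
Qed.

End ResolutionExistence.

(** * Facet ideals and expansions *)

Section FacetIdeal.

Variables (K : fieldType) (V : finType) (D : {set {set V}}).

Notation S := {mpoly K[#|V|]}.
Notation mon := 'X_{1..#|V|}.

Definition contains_facet (W : {set V}) : bool :=
  [exists F in facets D, F \subset W].

Lemma contains_facetS (W W' : {set V}) :
  W \subset W' -> contains_facet W -> contains_facet W'.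
Proof.
move=> sW /exists_inP[F FD sF]; apply/exists_inP; exists F => //.
exact: subset_trans sW.
Qed.

Definition mon_support (m : mon) : {set V} := [set v | m (enum_rank v) != 0%N].

Lemma indicator_le (F : {set V}) (m : mon) :
  (indicator F <= m)%MM = (F \subset mon_support m).
Proof.
apply/lem_rankP/subsetP => [le v vF|sF v].
  by have := le v; rewrite indicatorE vF inE lt0n.
rewrite indicatorE; case: (boolP (v \in F)) => // /sF.
by rewrite inE lt0n.
Qed.

Lemma face_monomialE (F : {set V}) : face_monomial K F = 'X_[indicator F].
Proof.
rewrite mpolyXE_id (reindex (@enum_rank V)) /=; last first.
  by exists enum_val => ? _; rewrite ?enum_rankK ?enum_valK.
rewrite /face_monomial big_mkcond; apply: eq_bigr => v _.
by rewrite indicatorE; case: (v \in F).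
Qed.

Lemma facet_idealP (p : S) : facet_ideal K D p <->
  forall m, p@_m != 0 -> contains_facet (mon_support m).
Proof.
split=> [[c ->] m|h].
  rewrite raddf_sum /= => cm; have [F /andP[FD Fm]] : exists F,
      (F \in facets D) && ((c F * face_monomial K F)@_m != 0).
    apply/existsP; apply: contraNT cm; rewrite negb_exists => /forallP h.
    rewrite big1 // => F FD; have := h F; rewrite FD /= negbK; exact/eqP.
  apply/exists_inP; exists F => //; rewrite -indicator_le.
  move: Fm; rewrite face_monomialE -mcoeff_msupp (perm_mem (msuppMX _ _)).
  by case/mapP => k _ ->; apply: lem_addr.
(* Each monomial of [p] is assigned to one facet dividing it; the coefficient of a facet gathers the
   quotients of its monomials. *)
pose pick m := odflt set0 [pick F in facets D | F \subset mon_support m].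
have pickP m : m \in msupp p ->
    (pick m \in facets D) && (pick m \subset mon_support m).
  rewrite mcoeff_msupp => /h/exists_inP[F FD Fm]; rewrite /pick.
  by case: pickP => //= /(_ F); rewrite FD Fm.
exists (fun F => \sum_(m <- msupp p | (m \in msupp p) && (pick m == F))
                    p@_m *: 'X_[m - indicator F]).
rewrite [LHS]mpolyE big_seq (partition_big pick (fun F => F \in facets D)) /=.
  apply: eq_bigr => F FD; rewrite mulr_suml.
  apply: eq_bigr => m /andP[mp /eqP mF].
  rewrite face_monomialE -scalerAl -mpolyXD submK // indicator_le -mF.
  by case/andP: (pickP m mp).
by move=> m /pickP/andP[].
Qed.

Lemma submodule_facet_ideal : submodule (ideal_row (facet_ideal K D)).
Proof.
split=> [|u v|p u]; rewrite /ideal_row !mxE.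
- by apply/facet_idealP => m; rewrite mcoeff0 eqxx.
- move=> /facet_idealP hu /facet_idealP hv; apply/facet_idealP => m.
  rewrite mcoeffD => uvm; have [u0|/hu //] := eqVneq (u 0 0)@_m 0.
  by apply: hv; rewrite u0 add0r in uvm.
by case=> c ->; exists (fun F => p * c F); rewrite mulr_sumr;
  apply: eq_bigr => F _; rewrite mulrA.
Qed.

Lemma facet_ideal_graded d p : facet_ideal K D p -> facet_ideal K D (zcomp d p).
Proof.
move=> /facet_idealP hp; apply/facet_idealP => m; rewrite mcoeff_zcomp.
by case: ifP => [_ /hp|]; rewrite ?eqxx.
Qed.

Variable lt : rel V.
Hypothesis lt_tour : tournament lt.

Notation vars := (fun v : V => 'X_(enum_rank v) : S).
Notation U := (fun m => contains_facet (mon_support m) : Prop).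

Lemma tor_monomial i j : tor_nonzero lt (facet_ideal K D) i j <->
  homology_nonzero lt (W := S^o) vars (monomial_chain U j) i.
Proof.
have to_row c p : monomial_chain U j p c ->
    koszul_chain (ideal_row (facet_ideal K D)) (fun=> 0) j p
      (fun s => const_mx (c s : S)).
  move=> Cc s; split.
  - by rewrite /ideal_row mxE; apply/facet_idealP => m /Cc[].
  - move=> a; rewrite mxE; apply/zhomogP => m /Cc[_ <- _].
    by rewrite subr0 PoszD addrK.
  - move=> c0; apply: NNPP => cs; case/eqP: c0; apply/rowP => a; rewrite !mxE.
    by apply/mpolyP => m; rewrite mcoeff0; apply/eqP/negPn/negP => /Cc[_ _ /cs].
have of_row c p : koszul_chain (ideal_row (facet_ideal K D)) (fun=> 0) j p c ->
    monomial_chain U j p (fun s => c s 0 0 : S^o).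
  move=> Cc s m cm; have [/facet_idealP/(_ _ cm) Um /(_ 0) + cs] := Cc s.
  rewrite subr0 => /zhomogP/(_ _ cm) mE; split=> //.
    by rewrite PoszD mE subrK.
  by apply: cs; apply: contraNneq cm => ->; rewrite mxE mcoeff0.
split=> -[c [Cc dc nbc]].
  exists (fun s => c s 0 0 : S^o); split=> [|s|[b Cb db]]; first exact: of_row.
    by rewrite -koszul_entry dc mxE.
  apply: nbc; exists (fun s => const_mx (b s : S)); first exact: to_row.
  move=> s; apply/rowP => a; rewrite ord1 koszul_entry -db.
  by apply: (@eq_koszul V lt S S^o vars) => s1; rewrite mxE.
exists (fun s => const_mx (c s : S)); split=> [|s|[b Cb db]];
  first exact: to_row.
  apply/rowP => a; rewrite koszul_entry mxE -[RHS](dc s).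
  by apply: (@eq_koszul V lt S S^o vars) => s1; rewrite mxE.
apply: nbc; exists (fun s => b s 0 0 : S^o); first exact: of_row.
by move=> s; rewrite -koszul_entry db mxE.
Qed.

(* The upper Koszul complex of the facet ideal in the squarefree multidegree
   [B]. *)
Definition squarefree_koszul (B s : {set V}) : Prop :=
  s \subset B /\ contains_facet (B :\: s).

Lemma tor_facet_ideal i j : tor_nonzero lt (facet_ideal K D) i j <->
  exists2 B : {set V}, #|B|%:Z = j &
    simplicial_nonzero K lt (squarefree_koszul B) i.
Proof.
rewrite tor_monomial homology_strand //.
have koszulE B s : upper_koszul U (indicator B) s <-> squarefree_koszul B s.
  rewrite /upper_koszul /squarefree_koszul indicator_le.
  have -> : mon_support (indicator B) = B.
    by apply/setP => v; rewrite inE indicatorE; case: (v \in B).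
  have -> // : mon_support (indicator B - indicator s) = B :\: s.
  apply/setP => v; rewrite !inE mnmBE !indicatorE.
  by case: (v \in B); case: (v \in s).
split=> [[b bj nz]|[B Bj nz]]; last first.
  exists (indicator B); first by rewrite mdeg_indicator.
  by apply: eq_simplicial_nonzero nz => s; rewrite koszulE.
(* If [u] has exponent at least 2, then [u] stays in the support of [b - indicator s] when it is
   added to [s], so the strand is a cone with apex [u]. *)
have [u bu|b1] := pickP (fun u => 1 < b (enum_rank u))%N.
  case: nz => c [Cc dc []]; apply: (cone_acyclic lt_tour (u := u)) => // s.
  case=> /lem_rankP sb Us; split.
    apply/lem_rankP => v; rewrite indicatorE in_setU1.
    case: eqVneq => [->|_] /=; first exact: ltnW.
    by have := sb v; rewrite indicatorE.
  apply: contains_facetS Us; apply/subsetP => v; rewrite !inE !mnmBE.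
  rewrite !indicatorE in_setU1; case: (eqVneq v u) => [->|_] //= _.
  by rewrite subn_eq0 -ltnNge.
have bE : b = indicator (mon_support b).
  apply: mnm_rankP => v; rewrite indicatorE inE.
  by have := b1 v; case: (b _) => [|[|]].
exists (mon_support b); first by rewrite -mdeg_indicator -bE.
by rewrite bE in nz; apply: eq_simplicial_nonzero nz => s; exact: koszulE.
Qed.

Lemma facet_ideal_resolution :
  inhabited (min_free_resolution (facet_ideal K D)).
Proof.
(* Homology lives in squarefree multidegrees, whose degree is at most [#|V|]. *)
apply: (resolution_exists lt_tour (D := #|V|%:Z)).
- exact: submodule_facet_ideal.
- exact: facet_ideal_graded.
move=> d p Vd /tor_facet_ideal[B Bd _]; have := max_card (mem B).
by rewrite -lez_nat Bd leNgt Vd.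
Qed.

Lemma betti_facet_ideal i j : betti (facet_ideal K D) i j <> 0%N <->
  exists2 B : {set V}, #|B|%:Z = j &
    simplicial_nonzero K lt (squarefree_koszul B) i.
Proof.
by rewrite (betti_tor lt_tour i j facet_ideal_resolution) tor_facet_ideal.
Qed.

End FacetIdeal.

(** * Squarefree strands of an expansion *)

Section Expansion.

Variables (K : fieldType) (V : finType) (D : {set {set V}}) (k : V -> nat).
Hypothesis k_gt0 : forall v, (0 < k v)%N.

Notation X := (expansion_vertex k).

(** A facet inside the projection of [W] lifts by choosing in [W] one copy of each of its
    vertices. *)
Lemma contains_facet_expansion (W : {set X}) :
  contains_facet (expansion k D) W =
  contains_facet D [set tag x | x in W].
Proof.
rewrite /contains_facet facets_expansion.
apply/exists_inP/exists_inP => -[F FD sF].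
  move: FD; rewrite inE => /andP[_ FD].
  by exists [set tag x | x in F]; rewrite // imsetS.
have ex i : exists x : X, i \in F -> x \in W /\ tag x = i.
  case: (boolP (i \in F)) => [/(subsetP sF)/imsetP[x xW ->]|_].
    by exists x.
  by exists (Tagged (fun i => 'I_(k i)) (Ordinal (k_gt0 i))).
have [f fP] := functional_choice ex.
exists (f @: F); last first.
  by apply/subsetP => _ /imsetP[i /fP[fW _] ->].
rewrite inE; apply/andP; split.
  apply/dinjectiveP => _ _ /imsetP[i /fP[_ fi] ->] /imsetP[i' /fP[_ fi'] ->].
  by rewrite fi fi' => ->.
suff -> : [set tag x | x in f @: F] = F by [].
apply/setP => i; apply/imsetP/idP => [[_ /imsetP[i' iF ->] ->]|iF].
  by case: (fP _ iF) => _ ->.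
by exists (f i); [apply: imset_f | case: (fP _ iF)].
Qed.

(** Induction on the size of [B]: as long as two copies of a vertex remain, [suspension] removes one
    of them. *)
Lemma injective_multidegree (lt : rel X) (B : {set X}) i :
  tournament lt ->
  simplicial_nonzero K lt (squarefree_koszul (expansion k D) B) i ->
  exists (B' : {set X}) i',
    [/\ {in B' &, injective (@tag V (fun i => 'I_(k i)))},
        #|B'|%:Z - i'%:Z = #|B|%:Z - i%:Z &
        simplicial_nonzero K lt (squarefree_koszul (expansion k D) B') i'].
Proof.
move=> lt_tour; move: {2}#|B| (erefl #|B|) => n.
elim: n B i => [|n IHn] B i cB nz.
  exists B, i; split=> // x y; move/eqP: cB; rewrite cards_eq0 => /eqP->.
  by rewrite inE.
have [/existsP[u /existsP[v /and4P[uB vB uv /eqP tuv]]]|inj] :=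
  boolP [exists u, exists v, [&& u \in B, v \in B, u != v & tag u == tag v]];
  last first.
  exists B, i; split=> // x y xB yB txy; apply/eqP; apply: contraNT inj => xy.
  apply/existsP; exists x; apply/existsP; exists y.
  by rewrite xB yB xy txy eqxx.
pose P := squarefree_koszul (expansion k D) B.
(* When [u] is removed, its copy [v] is still outside [s] and keeps the same vertex in the
   projection. *)
have P_cone (s : {set X}) : v \notin s -> P s -> P (u |: s).
  case=> vs [sB Fs]; split; first by rewrite subUset sub1set uB.
  move: Fs; rewrite !contains_facet_expansion; apply: contains_facetS.
  apply/subsetP => _ /imsetP[x xBs ->]; have [->|xu] := eqVneq x u.
    by rewrite tuv imset_f // !inE vB (negPf vs) eq_sym (negPf uv).
  by rewrite imset_f // in_setD in_setU1 negb_or xu -in_setD.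
have P_del (s : {set X}) : P (v |: s) -> P s.
  case=> sB Fs; split; first by apply: subset_trans sB; apply: subsetUr.
  by apply: contains_facetS Fs; apply: setDS; apply: subsetUr.
(* Homology vanishes in degree 0 here, so [i] can drop by one together with [#|B|]. *)
case: i nz => [|i] nz; first by case: (suspension0 lt_tour uv P_cone nz).
have cBv : #|B :\ v| = n by move: cB; rewrite (cardsD1 v) vB => -[].
have [|B' [i' [inj' dE nz']]] := IHn (B :\ v) i cBv.
  apply: eq_simplicial_nonzero (suspension lt_tour uv P_cone P_del nz) => s.
  rewrite /P /squarefree_koszul subUset sub1set vB /= subsetD1 setDDl.
  by split=> [[-> [-> ?]] //|[/andP[-> ->]]].
exists B', i'; split=> //; rewrite dE cB cBv; lia.
Qed.

(** Projecting the image of a set under the section [e] gives back the set, so both complexes impose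
    the same facet condition. *)
Lemma simplicial_nonzero_section (lt : rel X) (e : V -> X) (C : {set V}) i :
  cancel e (@tag V (fun i => 'I_(k i))) ->
  simplicial_nonzero K lt (squarefree_koszul (expansion k D) (e @: C)) i <->
  simplicial_nonzero K (relpre e lt) (squarefree_koszul D C) i.
Proof.
move=> eK; have e_inj := can_inj eK.
rewrite (simplicial_nonzero_relabel K lt e_inj) => [|s [sC _]]; last first.
  by apply: subset_trans sC (imsetS _ _); apply: subsetT.
have E (s : {set V}) : squarefree_koszul (expansion k D) (e @: C) (e @: s) <->
    squarefree_koszul D C s.
  rewrite /squarefree_koszul contains_facet_expansion.
  have -> : e @: C :\: e @: s = e @: (C :\: s).
    apply/setP => x; apply/setDP/imsetP => [[/imsetP[v vC ->]]|[v]].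
      by rewrite mem_imset // => vs; exists v => //; apply/setDP.
    by case/setDP=> vC vs ->; rewrite !mem_imset.
  have -> : [set tag x | x in e @: (C :\: s)] = C :\: s.
    by rewrite -imset_comp (eq_imset _ (g := id)) ?imset_id.
  suff -> : (e @: s \subset e @: C) = (s \subset C) by [].
  apply/idP/idP => [/subsetP sC|]; last exact: imsetS.
  by apply/subsetP => v vs; rewrite -(mem_imset C v e_inj) sC ?imset_f.
by split; apply: eq_simplicial_nonzero => s; rewrite E.
Qed.

Lemma shift_expansion (r : int) :
  (exists i j, betti (facet_ideal K D) i j <> 0%N /\ r = j - i%:Z) <->
  (exists i j, betti (facet_ideal K (expansion k D)) i j <> 0%N
     /\ r = j - i%:Z).
Proof.
pose lt : rel X := fun x y => ltn (enum_rank x) (enum_rank y).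
have lt_tour : tournament lt.
  move=> x y xy; rewrite /lt -leqNgt leq_eqVlt.
  by rewrite (inj_eq val_inj) (inj_eq enum_rank_inj) (negPf xy).
have pre_tour e : cancel e (@tag V (fun i => 'I_(k i))) ->
    tournament (relpre e lt).
  by move=> eK v w vw; apply: lt_tour; rewrite (can_eq eK).
split=> -[i [j [nz ->]]].
  pose e i : X := Tagged (fun i => 'I_(k i)) (Ordinal (k_gt0 i)).
  have eK : cancel e (@tag V (fun i => 'I_(k i))) by [].
  move/(betti_facet_ideal _ _ (pre_tour e eK)): nz => [C Cj nz].
  exists i, j; split=> //; apply/(betti_facet_ideal _ _ lt_tour).
  exists (e @: C); first by rewrite card_imset //; apply: can_inj eK.
  exact/simplicial_nonzero_section.
move/(betti_facet_ideal _ _ lt_tour): nz => [B <-].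
case/(injective_multidegree lt_tour) => B' [i' [inj <- nz]].
(* Since [B'] meets each fibre at most once, some section passes through all of [B']; fibres that
   miss [B'] get their first copy. *)
have ex v : exists x : X, tag x = v /\ forall y, y \in B' -> tag y = v -> x = y.
  case: (classic (exists2 y, y \in B' & tag y = v)) => [[y yB yv]|nex].
    by exists y; split=> // z zB zv; apply: inj; rewrite // yv.
  exists (Tagged (fun i => 'I_(k i)) (Ordinal (k_gt0 v))); split=> // y yB yv.
  by case: nex; exists y.
have [e eP] := functional_choice ex.
have eK : cancel e (@tag V (fun i => 'I_(k i))) by move=> v; case: (eP v).
have BE : B' = e @: [set tag x | x in B'].
  rewrite -imset_comp -[LHS]imset_id; apply: eq_in_imset => x xB /=.
  by case: (eP (tag x)) => _ /(_ x xB erefl) ->.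
exists i', #|[set tag x | x in B']|%:Z; split; last by rewrite card_in_imset.
apply/(betti_facet_ideal _ _ (pre_tour e eK)).
exists [set tag x | x in B'] => //.
by apply/(simplicial_nonzero_section lt _ _ eK); rewrite -BE.
Qed.

End Expansion.

Lemma linear_resolution_shift (K : fieldType) (N : nat)
    (I : {mpoly K[N]} -> Prop) :
  has_linear_resolution I <->
  exists d : int, forall r,
    (exists i j, betti I i j <> 0%N /\ r = j - i%:Z) -> r = d.
Proof.
split=> -[d h]; exists d.
  move=> r [i [j [nz ->]]]; apply: NNPP => ne; apply: nz; apply: h => jd.
  by apply: ne; rewrite jd addrC addKr.
move=> i j jd; apply: NNPP => nz; apply: jd.
by rewrite -(h (j - i%:Z)) ?subrKC //; exists i, j.
Qed.

Theorem corollary3p5 (K : fieldType) (n : nat) (Delta : {set {set 'I_n}})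
    (alpha : 'I_n -> nat) (hDelta : simplicial_complex Delta)
    (halpha : forall i : 'I_n, (0 < alpha i)%N) :
  regularity (facet_ideal K Delta)
    = regularity (facet_ideal K (expansion alpha Delta))
  /\ (has_linear_resolution (facet_ideal K Delta)
      <-> has_linear_resolution (facet_ideal K (expansion alpha Delta))).
Proof.
have shift r := shift_expansion K Delta halpha r.
split.
  (* [int_max] depends only on its predicate, and the two sets of differences coincide. *)
  rewrite /regularity; congr int_max; apply: functional_extensionality => r.
  exact/propositional_extensionality/shift.
rewrite !linear_resolution_shift.
by split=> -[d h]; exists d => r /shift/h.
Qed.
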